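(* Let $0<s<1$, $a=1-2s$, and $f\in\mathcal D((-L)^s)$. Let $U$ be the $s$-harmonic extension of $f$. Then $$(-L)^sf=-\frac{2^{2s-1}\Gamma(s)}{\Gamma(1-s)}\lim_{y\to0^+}y^a\frac{\partial U}{\partial y}(\cdot,y),$$ where the identity holds in $L^2(X,\mu)$.
   Context: $(X,d)$ is a locally compact metric space with a Radon measure $\mu$ supported on $X$. $(\mathcal E,\mathcal F)$ is a Dirichlet form on $L^2(X,\mu)$ (densely defined, closed, symmetric, Markovian bilinear form). $L$ is its generator, i.e. the non-positive self-adjoint operator on $L^2(X,\mu)$ with $\mathcal F=\mathcal D(\sqrt{-L})$ and $\mathcal E(u,v)=\langle\sqrt{-L}u,\sqrt{-L}v\rangle$. $P_t=e^{tL}$ is the heat semigroup. It is assumed that $L$ has no spectral gap, i.e. the spectrum of $-L$ meets $(0,\varepsilon)$ for every $\varepsilon>0$. The operator $(-L)^s$ is defined by the spectral theorem. The $s$-harmonic extension of $f$ is the function on $X\times(0,\infty)$ given by the Poisson formula $$U(\cdot,y)=\frac{y^{2s}}{2^{2s}\Gamma(s)}\int_0^{+\infty}(P_tf)\,e^{-\frac{y^2}{4t}}\,\frac{dt}{t^{1+s}},\qquad y>0,$$ the integral being understood in $L^2(X,\mu)$; the $y$-derivative is the derivative of $y\mapsto U(\cdot,y)\in L^2(X,\mu)$. $\Gamma(\cdot)$ in the formulas is Euler's Gamma function. *)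

(* Defs.v *)
From HB Require Import structures.
From mathcomp Require Import all_boot all_order all_algebra.
From mathcomp Require Import all_classical all_reals all_analysis.

Set Implicit Arguments.
Unset Strict Implicit.
Unset Printing Implicit Defensive.

Import Order.TTheory GRing.Theory Num.Theory.
Import numFieldNormedType.Exports.

Local Open Scope classical_set_scope.
Local Open Scope ring_scope.

(* A measurableType has to be pointed, hence the base point. *)
#[short(type="pmetricType")]
HB.structure Definition PointedMetric (K : numDomainType) :=
  {M of Pointed M & Metric K M}.

Definition borel (R : realType) (X : pmetricType R) :=
  g_sigma_algebraType (@open X).

Section Radon.
Context (R : realType) (X : pmetricType R).
Variable mu : {measure set (borel X) -> \bar R}.

Definition radon : Prop :=
  [/\ forall K : set X, compact K -> (mu K < +oo)%E,
      forall A : set (borel X), measurable A ->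
        mu A = ereal_inf [set mu V | V in [set V : set X | open V /\ A `<=` V]]
    & forall V : set X, open V ->
        mu V = ereal_sup
          [set mu K | K in [set K : set X | compact K /\ K `<=` V]]].

Definition full_support : Prop :=
  forall V : set X, open V -> V !=set0 -> (0 < mu V)%E.

End Radon.

Notation L2 mu := (LfunType mu (lee1n 2)).

(* Elements of L2 are represented by square-integrable functions, so that
   equality in L^2(T, mu) is equality mu-almost everywhere. *)
Section L2_theory.
Context d (T : measurableType d) (R : realType).
Variable mu : {measure set T -> \bar R}.

Local Notation L2 := (L2 mu).

Definition L2eq (f g : L2) : Prop := f = g %[ae mu].

Definition L2dot (f g : L2) : R := \int[mu]_x (f x * g x).

Definition L2norm (f : L2) : R := fine ('N[mu]_2%:E [EFin \o f])%E.

Definition L2cvg {I : Type} (F : set_system I) (u : I -> L2) (l : L2) : Prop :=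
  (fun i => L2norm (u i - l)) @ F --> (0 : R).

Definition L2dense (D : set L2) : Prop :=
  forall f (e : R), 0 < e -> exists2 g, D g & L2norm (f - g) < e.

Definition is_L2derive (U : R -> L2) (y : R) (v : L2) : Prop :=
  L2cvg (0 : R)^' (fun h : R => h^-1 *: (U (y + h) - U y)) v.

(* Bochner integral over D with respect to the Lebesgue measure.  The list s
   of pairs (A, v) encodes the simple function t |-> \sum 1_A(t) v. *)
Definition L2simple (s : seq (set R * L2)) (t : R) : L2 :=
  \sum_(Av <- s) (\1_(Av.1) t : R) *: Av.2.

Definition L2simple_integral (s : seq (set R * L2)) : L2 :=
  \sum_(Av <- s) fine (@lebesgue_measure R Av.1) *: Av.2.

Definition L2simple_on (D : set R) (s : seq (set R * L2)) : Prop :=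
  forall A v, (A, v) \in s ->
    [/\ measurable A, A `<=` D & (@lebesgue_measure R A < +oo)%E].

Definition is_L2integral (D : set R) (F : R -> L2) (I : L2) : Prop :=
  exists s : nat -> seq (set R * L2),
    [/\ forall k, L2simple_on D (s k),
        forall k, measurable_fun D (fun t => L2norm (F t - L2simple (s k) t)),
        (\int[@lebesgue_measure R]_(t in D)
           (L2norm (F t - L2simple (s k) t))%:E)%E @[k --> \oo] --> (0 : \bar R)
      & L2cvg \oo (fun k => L2simple_integral (s k)) I].

(* A possibly unbounded operator is given by its graph: A f g reads "f is in
   the domain of A and A f = g". *)
Definition operator : Type := L2 -> L2 -> Prop.

Definition op_dom (A : operator) : set L2 := [set f | exists g, A f g].

Definition op_opp (A : operator) : operator := fun f g => A f (- g).

Definition op_adjoint (A : operator) : operator :=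
  fun f g => forall u v, A u v -> L2dot v f = L2dot u g.

Definition self_adjoint (A : operator) : Prop :=
  L2dense (op_dom A) /\ forall f g, A f g <-> op_adjoint A f g.

Definition non_positive (A : operator) : Prop :=
  forall f g, A f g -> L2dot g f <= 0.

(* l is in the resolvent set when A - l is a bijection from the domain of A
   onto L2 with bounded inverse; the estimate includes injectivity. *)
Definition resolvent_set (A : operator) : set R :=
  [set l | (forall h, exists f g, A f g /\ L2eq (g - l *: f) h) /\
           exists C, forall f g, A f g -> L2norm f <= C * L2norm (g - l *: f)].

Definition spectrum (A : operator) : set R := ~` resolvent_set A.

Definition no_spectral_gap (L : operator) : Prop :=
  forall e : R, 0 < e -> exists l, [/\ 0 < l, l < e & spectrum (op_opp L) l].

(* Projection-valued measure on the Borel sets of R.  Countable additivity is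
   the fact that B |-> <E B f, f> is given by a measure. *)
Record projection_measure := ProjectionMeasure {
  pm_proj :> set R -> L2 -> L2 ;
  pm_measure : L2 -> {measure set R -> \bar R} ;
  pm_linear : forall B, measurable B -> forall a f g,
    L2eq (pm_proj B (a *: f + g)) (a *: pm_proj B f + pm_proj B g) ;
  pm_symmetric : forall B, measurable B -> forall f g,
    L2dot (pm_proj B f) g = L2dot f (pm_proj B g) ;
  pm_setI : forall B C, measurable B -> measurable C -> forall f,
    L2eq (pm_proj (B `&` C) f) (pm_proj B (pm_proj C f)) ;
  pm_setT : forall f, L2eq (pm_proj setT f) f ;
  pm_measureE : forall f B, measurable B ->
    pm_measure f B = (L2dot (pm_proj B f) f)%:E }.

Definition calculus_dom (E : projection_measure) (phi : R -> R) : set L2 :=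
  [set f | (\int[pm_measure E f]_l ((phi l) ^+ 2)%:E < +oo)%E].

(* The graph of \int phi dE.  The integral of phi against the signed measure
   B |-> <E B f, h> is written by polarization; it is enough to test against h
   in the domain, which is dense. *)
Definition calculus (E : projection_measure) (phi : R -> R) : operator :=
  fun f g => calculus_dom E phi f /\
    forall h, calculus_dom E phi h ->
      L2dot g h = (\int[pm_measure E (f + h)]_l phi l
                   - \int[pm_measure E (f - h)]_l phi l) / 4.

(* E is the spectral resolution of the non-negative operator - L. *)
Definition spectral_resolution (L : operator) (E : projection_measure) : Prop :=
  (forall f, L2eq (E `]-oo, 0[%classic f) 0) /\
  forall f g, op_opp L f g <-> calculus E (fun l => l) f g.

Definition frac_power (E : projection_measure) (s : R) : operator :=
  calculus E (fun l => l `^ s).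

Definition heat_semigroup (E : projection_measure) (P : R -> L2 -> L2) : Prop :=
  forall t f, 0 <= t -> calculus E (fun l => expR (- (t * l))) f (P t f).

(* Dom is the domain of the form; the values of En outside of it are
   irrelevant. *)
Record dirichlet_form (Dom : set L2) (En : L2 -> L2 -> R) : Prop := {
  df_compat : forall f g, L2eq f g -> Dom f ->
    Dom g /\ forall h, Dom h -> En f h = En g h ;
  df_dom0 : Dom 0 ;
  df_domP : forall a f g, Dom f -> Dom g -> Dom (a *: f + g) ;
  df_linear : forall a f g h, Dom f -> Dom g -> Dom h ->
    En (a *: f + g) h = a * En f h + En g h ;
  df_symmetric : forall f g, Dom f -> Dom g -> En f g = En g f ;
  df_ge0 : forall f, Dom f -> 0 <= En f f ;
  df_dense : L2dense Dom ;
  df_closed : forall u : nat -> L2, (forall n, Dom (u n)) ->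
    (forall e : R, 0 < e -> exists N, forall m n, (N <= m)%N -> (N <= n)%N ->
       En (u m - u n) (u m - u n) + L2norm (u m - u n) ^+ 2 < e) ->
    exists2 v, Dom v &
      (En (u n - v) (u n - v) + L2norm (u n - v) ^+ 2) @[n --> \oo] --> (0 : R) ;
  df_markov : forall f g : L2, Dom f ->
    (fun x => Num.min (Num.max (f x) 0) 1) = g %[ae mu] ->
    Dom g /\ En g g <= En f f }.

Definition generator (Dom : set L2) (En : L2 -> L2 -> R) (L : operator)
    (E : projection_measure) : Prop :=
  [/\ self_adjoint L, non_positive L, spectral_resolution L E,
      forall f, Dom f <-> op_dom (calculus E Num.sqrt) f
    & forall f g f' g', calculus E Num.sqrt f f' -> calculus E Num.sqrt g g' ->
        En f g = L2dot f' g'].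

End L2_theory.

Definition Gamma (R : realType) (x : R) : R :=
  \int[@lebesgue_measure R]_(t in `]0, +oo[%classic) (t `^ (x - 1) * expR (- t)).

Definition harmonic_extension d (T : measurableType d) (R : realType)
    (mu : {measure set T -> \bar R}) (P : R -> L2 mu -> L2 mu) (s : R)
    (f : L2 mu) (U : R -> L2 mu) : Prop :=
  forall y, 0 < y -> exists2 I : L2 mu,
    is_L2integral `]0, +oo[%classic
      (fun t => (expR (- (y ^+ 2 / (4 * t))) / t `^ (1 + s)) *: P t f) I
    & L2eq (U y) ((y `^ (2 * s) / (2 `^ (2 * s) * Gamma s)) *: I).

(* Main.v *)
Require Import Defs.
From HB Require Import structures.
From mathcomp Require Import all_boot all_order all_algebra finmap.
From mathcomp Require Import all_classical all_reals all_analysis.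
From mathcomp Require Import measurable_realfun ring lra.

(* On the spectral side [U y] is [u_y(-L) f], where the substitution
   [r = y^2 / 4t] in the Poisson formula gives
     [u_y(l) = K_s(y^2 l / 4) / Gamma s],
     [K_p(w) = \int_0^oo exp(- w / t - t) t^(p-1) dt].
   Differentiating under the integral, [K_s' = - K_(s-1)], and the inversion
   [t -> w / t] gives [K_(s-1)(w) = w^(s-1) K_(1-s)(w)], hence
     [y^(1-2s) d/dy u_y(l) = - 2^(1-2s) / Gamma s * l^s * K_(1-s)(y^2 l / 4)].
   This is bounded by a multiple of [l^s], and tends to
   [- 2^(1-2s) Gamma(1-s) / Gamma s * l^s] as [y -> 0].  Since [l^s] is square
   integrable for the spectral measure of [f], dominated convergence there
   yields both the [L^2] derivative and its limit; the derivative exists as an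
   element of [L^2] by completeness. *)

Set Implicit Arguments.
Unset Strict Implicit.
Unset Printing Implicit Defensive.

Import Order.TTheory GRing.Theory Num.Theory.
Import numFieldNormedType.Exports.

Local Open Scope classical_set_scope.
Local Open Scope ring_scope.

(** * The Hilbert space L2 *)

(** The symbols converge in [L^2] of the spectral measure of [f]; the difficulty is to carry this
    over to [L^2(mu)]. In its place stands the estimate [||g||^2 <= 2 \int phi^2], integrated
    against the spectral measure of [f], for [g] representing [phi] at [f]. It rests on the
    positivity of the spectral measures of [h + 2 c f] and [h - 2 c f]: expanded, this is Young's
    inequality on each Borel set, and it integrates once [c] is taken to be the value of [phi] on a
    level set. The factor 2 is harmless, since the estimate only serves to send differences to zero.
    Two dominations are needed. For fixed [y] the difference quotients are bounded by a multiple of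
    [|l|^s] whose constant depends on [y]; as [y -> 0] the factor [y^(1-2s)] makes the constant
    uniform. *)

Section L2_inner_product.
Context d (T : measurableType d) (R : realType).
Variable mu : {measure set T -> \bar R}.
Local Notation L2 := (L2 mu).
Implicit Types f g h : L2.

Lemma L2_measurable f : measurable_fun setT f.
Proof. exact: measurable_funP. Qed.

Lemma L2_integrableM f g : mu.-integrable setT (EFin \o (fun x => f x * g x)).
Proof.
apply/Lfun1_integrable; have lf := LfunP f; have lg := LfunP g.
exact: (Lfun2_mul_Lfun1 lf lg).
Qed.

Lemma L2dotC f g : L2dot f g = L2dot g f.
Proof. by apply: eq_Rintegral => x _; rewrite mulrC. Qed.

Lemma L2dotDl f g h : L2dot (f + g) h = L2dot f h + L2dot g h.
Proof.
rewrite /L2dot -RintegralD//; [|exact: L2_integrableM|exact: L2_integrableM].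
by apply: eq_Rintegral => x _; rewrite mulrDl.
Qed.

Lemma L2dotZl c f h : L2dot (c *: f) h = c * L2dot f h.
Proof.
rewrite /L2dot -RintegralZl//; last exact: L2_integrableM.
by apply: eq_Rintegral => x _; rewrite -mulrA.
Qed.

Lemma L2dotNl f h : L2dot (- f) h = - L2dot f h.
Proof. by rewrite -scaleN1r L2dotZl mulN1r. Qed.

Lemma L2dotBl f g h : L2dot (f - g) h = L2dot f h - L2dot g h.
Proof. by rewrite L2dotDl L2dotNl. Qed.

Lemma L2dot0l h : L2dot (0 : L2) h = 0.
Proof. by rewrite -(scale0r (0 : L2)) L2dotZl mul0r. Qed.

Lemma L2dotDr f g h : L2dot h (f + g) = L2dot h f + L2dot h g.
Proof. by rewrite !(L2dotC h) L2dotDl. Qed.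

Lemma L2dotNr f h : L2dot h (- f) = - L2dot h f.
Proof. by rewrite !(L2dotC h) L2dotNl. Qed.

Lemma L2dotZr c f h : L2dot h (c *: f) = c * L2dot h f.
Proof. by rewrite !(L2dotC h) L2dotZl. Qed.

Lemma L2dot_ge0 f : 0 <= L2dot f f.
Proof. by apply: Rintegral_ge0 => x _; rewrite -expr2 sqr_ge0. Qed.

Lemma eq_L2dotl f g h : L2eq f g -> L2dot f h = L2dot g h.
Proof.
move=> fg; congr fine; apply: ae_eq_integral => //.
- by apply/measurable_EFinP/measurable_funM; exact: L2_measurable.
- by apply/measurable_EFinP/measurable_funM; exact: L2_measurable.
- by apply: filterS fg => x /= /(_ I) ->.
Qed.

Lemma L2norm_ge0 f : 0 <= L2norm f.
Proof. by rewrite fine_ge0// Lnorm_ge0. Qed.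

Lemma L2norm_sqr f : L2norm f ^+ 2 = L2dot f f.
Proof.
have n2 : (2 : R) != 0 by rewrite pnatr_eq0.
have H := poweR_Lnorm mu (EFin \o f) n2.
rewrite -powR_mulrn ?L2norm_ge0// -[LHS]/(fine (L2norm f `^ 2)%:E).
rewrite -poweR_EFin (finite_norm_fine f) H; congr fine.
apply: eq_integral => x _; congr EFin.
by rewrite /= powR_mulrn// -normrX ger0_norm ?sqr_ge0// expr2.
Qed.

Lemma L2norm_le f (c : R) : 0 <= c -> (L2norm f <= c) = (L2dot f f <= c ^+ 2).
Proof. by move=> c0; rewrite -L2norm_sqr ler_sqr// nnegrE L2norm_ge0. Qed.

Lemma L2norm_eqE f g : L2dot f f = L2dot g g -> L2norm f = L2norm g.
Proof.
move=> fg; apply/eqP; rewrite eq_le !L2norm_le ?L2norm_ge0// !L2norm_sqr fg.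
by rewrite lexx.
Qed.

Lemma L2_CauchySchwarz f g : `|L2dot f g| <= L2norm f * L2norm g.
Proof.
have A0 := L2dot_ge0 f; have B0 := L2dot_ge0 g.
rewrite -ler_sqr ?nnegrE ?mulr_ge0 ?L2norm_ge0// exprMn !L2norm_sqr.
rewrite real_normK ?num_real//.
have q a b : 0 <= a ^+ 2 * L2dot f f + 2 * (a * b * L2dot f g) + b ^+ 2 * L2dot g g.
  have := L2dot_ge0 (a *: f + b *: g).
  rewrite !(L2dotDl, L2dotDr, L2dotZl, L2dotZr) (L2dotC g f); lra.
move: A0 B0 q; set A := L2dot f f; set B := L2dot g g; set C := L2dot f g.
(* A vector of norm zero need not be the zero function, so [B = 0] is treated by the quadratic form
   too: the choice [(- C, A + 1)] gives [C^2 (A + 2) <= 0], with a positive coefficient even if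
   [A = 0]. *)
move=> A0 B0 q; have [B1|/eqP B1] := eqVneq B 0.
  have := q (- C) (A + 1); rewrite B1 mulr0; nra.
have := q B (- C); have Bp : 0 < B by rewrite lt_neqAle B0 eq_sym andbT; exact/eqP.
by move=> h; rewrite -(ler_pM2l Bp); nra.
Qed.

Lemma L2cvg_dot (I : Type) (F : set_system I) {FF : Filter F} (u : I -> L2) l h :
  L2cvg F u l -> L2dot (u i) h @[i --> F] --> L2dot l h.
Proof.
move=> ul; apply/cvgrPdistC_lt => e e0.
have h1 : 0 < L2norm h + 1 by rewrite ltr_wpDl ?L2norm_ge0.
have /cvgr0_norm_lt/(_ _ (divr_gt0 e0 h1)) := ul.
apply: filterS => i; rewrite ger0_norm ?L2norm_ge0// ltr_pdivlMr// => lt.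
rewrite -L2dotBl (le_lt_trans (L2_CauchySchwarz _ _))// (le_lt_trans _ lt)//.
by rewrite ler_wpM2l ?L2norm_ge0// lerDl.
Qed.

(** * Square-integrable functions and completeness (Riesz-Fischer) *)

Lemma L2_of_sqr_integrable (f : T -> R) : measurable_fun setT f ->
  (\int[mu]_x (f x ^+ 2)%:E < +oo)%E -> exists g : L2, g = f :> (T -> R).
Proof.
move=> mf fi; have lf : f \in Lfun mu 2%:R%:E.
  apply/andP; split; rewrite inE/=; last rewrite /finite_norm. exact: mf.
  rewrite unlock poweR_lty//.
  apply: le_lt_trans fi; rewrite le_eqVlt; apply/orP; left; apply/eqP.
  apply: eq_integral => x _ /=; congr EFin.
  by rewrite powR_mulrn// -normrX ger0_norm ?sqr_ge0.
by exists (@Lfun_Sub _ _ _ _ _ (lee1n 2) _ lf).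
Qed.

Lemma integral_sqr_L2 f : (\int[mu]_x (f x ^+ 2)%:E = (L2dot f f)%:E)%E.
Proof.
rewrite /L2dot /Rintegral fineK.
  by apply: eq_integral => x _; rewrite expr2.
exact/integrable_fin_num/L2_integrableM.
Qed.

(* AM-GM: [|x| <= 2^k x^2 + 2^-k]. *)
Lemma cvg_of_weighted_sqr_sum (w : nat -> R) :
  (\sum_(k <oo) (2 ^+ k * (w k.+1 - w k) ^+ 2)%:E < +oo)%E -> cvgn w.
Proof.
set S := (X in (X < _)%E) => Sfin.
have t0 k : (0 <= (2 ^+ k * (w k.+1 - w k) ^+ 2)%:E)%E.
  by rewrite lee_fin mulr_ge0 ?sqr_ge0 ?exprn_ge0.
have S0 : (0 <= S)%E by rewrite /S nneseries_ge0// => n _ _; exact: t0.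
have cS : cvgn (series (fun k => 2 ^+ k * (w k.+1 - w k) ^+ 2)).
  apply: nondecreasing_is_cvgn.
    by apply: nondecreasing_series => n _ _; rewrite -lee_fin.
  exists (fine S) => _ [n _ <-].
  rewrite -lee_fin fineK ?ge0_fin_numE// /series/= -sumEFin.
  exact: nneseries_lim_ge.
have cG : cvgn (series (geometric 1 (2^-1 : R))).
  by apply: is_cvg_geometric_series; rewrite ger0_norm ?invr_ge0// invf_lt1// ltr1n.
have : cvgn (series (fun k => (w k.+1 - w k : R^o))).
  apply: normed_cvg.
  have := is_cvg_seriesD cS cG; apply: series_le_cvg => [n|n|n]; first exact: normr_ge0.
    change (0 <= 2 ^+ n * (w n.+1 - w n) ^+ 2 + 1 * 2^-1 ^+ n).
    by rewrite addr_ge0//; exact: (t0 n).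
  change (`|w n.+1 - w n| <= 2 ^+ n * (w n.+1 - w n) ^+ 2 + 1 * 2^-1 ^+ n).
  rewrite mul1r exprVn.
  set e := w _ - _; have p2 : 0 < 2 ^+ n :> R by rewrite exprn_gt0.
  rewrite -(ler_pM2l p2) mulrDr mulfV; last by rewrite gt_eqF.
  have -> : e ^+ 2 = `|e| ^+ 2 by rewrite real_normK ?num_real.
  set z := 2 ^+ n * `|e|.
  have -> : 2 ^+ n * (2 ^+ n * `|e| ^+ 2) = z ^+ 2 by rewrite /z; ring.
  nra.
move=> /cvg_ex[/= l wl]; apply/cvg_ex; exists (l + w 0%N).
rewrite -(cvg_shiftn 0).
have -> : (fun n => w (n + 0)%N) = (fun n => series (fun k => w k.+1 - w k) n + w 0%N).
  by apply/funext => n; rewrite addn0 /series/= telescope_sumr// subrK.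
by apply: cvgD wl _; exact: cvg_cst.
Qed.

Lemma limn_einf_le (u : (\bar R)^nat) c : (forall n, u n <= c)%E ->
  (limn_einf u <= c)%E.
Proof.
move=> uc; rewrite limn_einf_lim; apply: lime_le; first exact: is_cvg_einfs.
apply: nearW => n; apply: le_trans (uc n).
by apply: ereal_inf_lbound; exists n => //=.
Qed.

(** Fatou's lemma for [(u - w k)^2]. The limit [v] is only known to be measurable, hence an integral
    with values in the extended reals; its finiteness is what later places [u - v] in [L2]. *)
Lemma L2_fatou (w : nat -> L2) (u : L2) (v : T -> R) c : measurable_fun setT v ->
  (forall k, L2dot (u - w k) (u - w k) <= c) ->
  {ae mu, forall x, (w k x) @[k --> \oo] --> v x} ->
  (\int[mu]_x ((u x - v x) ^+ 2)%:E <= c%:E)%E.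
Proof.
move=> mv uwc wv.
have mk k : measurable_fun setT (EFin \o (fun x => (u x - w k x) ^+ 2)).
  by apply/measurable_EFinP/measurable_funX/measurable_funB; exact: L2_measurable.
have -> : (\int[mu]_x ((u x - v x) ^+ 2)%:E =
    \int[mu]_x limn_einf (fun k => ((u x - w k x) ^+ 2)%:E))%E.
  apply: ae_eq_integral => //.
  - by apply/measurable_EFinP/measurable_funX/measurable_funB => //; exact: L2_measurable.
  - rewrite /limn_einf; apply: (measurableT_comp (f := -%E)) => //.
    apply: measurable_fun_limn_esup => n.
    by apply: (measurableT_comp (f := -%E)) => //; exact: mk.
  - apply: filterS wv => x wv _.
    have c1 : ((u x - w k x) ^+ 2)%:E @[k --> \oo] --> ((u x - v x) ^+ 2)%:E.
      apply/fine_cvgP; split; first by apply: filterE.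
      rewrite /comp/=.
      apply: (@cvg_comp _ _ _ (fun k => u x - w k x) (fun z => z ^+ 2)).
        by apply: cvgB; [exact: cvg_cst|exact: wv].
      exact: exprn_continuous.
    by rewrite is_cvg_limn_einfE; [apply/esym/cvg_lim|apply/cvg_ex; eexists; exact: c1].
apply: (le_trans (fatou mu measurableT mk _)).
  by move=> n x _; rewrite lee_fin sqr_ge0.
apply: limn_einf_le => k.
have -> : (\int[mu]_x (EFin \o (fun x => (u x - w k x) ^+ 2)%R) x =
    \int[mu]_x (((u - w k) x) ^+ 2)%:E)%E by [].
by rewrite integral_sqr_L2 lee_fin.
Qed.

(** The rate [4^-(k+1)] beats the weight [2^k] of [cvg_of_weighted_sqr_sum]: the weighted sum of
    squared increments has a finite integral, so it is finite almost everywhere. *)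
Lemma L2_ae_cvg (w : nat -> L2) :
  (forall k, L2dot (w k.+1 - w k) (w k.+1 - w k) <= (4 ^+ k.+1)^-1) ->
  {ae mu, forall x, cvgn (fun k => w k x)}.
Proof.
move=> wk.
pose t k x : \bar R := (2 ^+ k * (w k.+1 x - w k x) ^+ 2)%:E.
have mt k : measurable_fun setT (t k).
  apply/measurable_EFinP/measurable_funM => //.
  by apply/measurable_funX/measurable_funB; exact: L2_measurable.
have t0 k x : (0 <= t k x)%E.
  by rewrite lee_fin mulr_ge0 ?sqr_ge0 ?exprn_ge0.
have iS : (\int[mu]_x (\sum_(k <oo) t k x) < +oo)%E.
  rewrite integral_nneseries//.
  apply: (@le_lt_trans _ _ (\sum_(k <oo) (1 / (2 ^ (k + 1))%:R : R)%:E)%E).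
    apply: lee_nneseries => [k _ _|k _]; first by apply: integral_ge0.
    have -> : (\int[mu]_x t k x =
        \int[mu]_x ((2 ^+ k)%:E * ((w k.+1 x - w k x) ^+ 2)%:E))%E.
      by apply: eq_integral => x _; rewrite -EFinM.
    rewrite ge0_integralZl//; last 2 first.
    - by apply/measurable_EFinP/measurable_funX/measurable_funB; exact: L2_measurable.
    - by move=> x _; rewrite lee_fin sqr_ge0.
    have -> : (\int[mu]_x ((w k.+1 x - w k x) ^+ 2)%:E =
        \int[mu]_x (((w k.+1 - w k) x) ^+ 2)%:E)%E by [].
    rewrite integral_sqr_L2 -EFinM lee_fin.
    apply: le_trans (ler_wpM2l _ (wk k)) _; first by rewrite exprn_ge0.
    rewrite natrX addn1 -[4]/(2 * 2)%:R natrM exprMn invfM mulrA div1r.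
    rewrite -[leRHS]mul1r ler_wpM2r ?invr_ge0 ?exprn_ge0//.
    by rewrite ler_pdivrMr ?exprn_gt0// mul1r ler_weXn2l// ler1n.
  by have /cvg_lim -> // := @cvg_geometric_eseries_half R 1 0; rewrite ltry.
have mS : measurable_fun setT (fun x => \sum_(k <oo) t k x)%E.
  by apply: ge0_emeasurable_sum.
have /integrable_ae : mu.-integrable setT (fun x => \sum_(k <oo) t k x)%E.
  apply/integrableP; split => //.
  by under eq_integral do rewrite gee0_abs ?nneseries_ge0//.
move=> /(_ measurableT); apply: filterS => x /(_ I) fx.
apply: cvg_of_weighted_sqr_sum.
by move: fx; rewrite ge0_fin_numE ?nneseries_ge0.
Qed.

Lemma L2_complete (u : nat -> L2) :
  (forall e : R, 0 < e -> exists N, forall m n, (N <= m)%N -> (N <= n)%N ->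
    L2norm (u m - u n) < e) ->
  exists v, L2cvg \oo u v.
Proof.
move=> cu.
have e2 k : 0 < ((2 : R) ^+ k.+1)^-1 by rewrite invr_gt0 exprn_gt0.
have /choice[N NP] := fun k => cu _ (e2 k).
(* The maximum puts both [p k] and [p k.+1] beyond [N k]; the summand [k] makes [p k >= k], so that
   tails of the subsequence are tails of [u]. *)
pose p k := (k + \max_(i < k.+1) N i)%N.
have pN k : (N k <= p k)%N.
  by rewrite (leq_trans _ (leq_addl _ _))// (leq_bigmax (Ordinal (ltnSn k))).
have pS k : (N k <= p k.+1)%N.
  rewrite (leq_trans _ (leq_addl _ _))//.
  by rewrite (leq_bigmax (F := fun i : 'I_k.+2 => N i) (widen_ord (leqnSn _) (Ordinal (ltnSn k)))).
pose w k := u (p k).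
have wk k : L2dot (w k.+1 - w k) (w k.+1 - w k) <= (4 ^+ k.+1)^-1.
  rewrite -L2norm_sqr.
  have -> : ((4 : R) ^+ k.+1)^-1 = (((2 : R) ^+ k.+1)^-1) ^+ 2.
    by rewrite -[4]/(2 * 2)%:R natrM -expr2 exprVn -!exprM mulnC.
  by rewrite ler_sqr ?nnegrE ?L2norm_ge0 ?ltW// NP.
have cw := L2_ae_cvg wk.
(* The upper limit is measurable without any convergence assumption and agrees with the limit
   wherever the latter exists. *)
pose v x := fine (limn_esup (fun k => (w k x)%:E)).
have mv : measurable_fun setT v.
  apply: measurableT_comp => //; apply: measurable_fun_limn_esup => n.
  by apply/measurable_EFinP; exact: L2_measurable.
have wv : {ae mu, forall x, (w k x) @[k --> \oo] --> v x}.
  apply: filterS cw => x /cvg_ex[/= l wl].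
  have wlE : (w k x)%:E @[k --> \oo] --> l%:E by apply/fine_cvgP; split => //; apply: filterE.
  rewrite /v is_cvg_limn_esupE; last by apply/cvg_ex; eexists; exact: wlE.
  by move/cvg_lim : wlE => ->.
have key (e : R) : 0 < e -> exists M, forall n, (M <= n)%N ->
    (\int[mu]_x ((u n x - v x) ^+ 2)%:E <= (e ^+ 2)%:E)%E.
  move=> e0; have [M MP] := cu e e0; exists M => n Mn.
  apply: (L2_fatou (w := fun k => w (k + M)%N)) => //.
    move=> k; rewrite -L2norm_le ?ltW// MP//.
    by rewrite (leq_trans _ (leq_addr _ _))// leq_addl.
  by apply: filterS wv => x; rewrite -(cvg_shiftn M).
have [M0 /(_ M0 (leqnn _)) M0P] := key 1 ltr01.
(* Fatou bounds [u M0 - v], not [v] itself, so [v] enters [L2] as the difference [u M0 - dv]. *)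
have [dv dvE] : exists g : L2, g = (fun x => u M0 x - v x) :> (T -> R).
  apply: L2_of_sqr_integrable.
    by apply: measurable_funB => //; exact: L2_measurable.
  by rewrite (le_lt_trans M0P)// ltry.
exists (u M0 - dv).
have uv n x : (u n - (u M0 - dv)) x = u n x - v x.
  by rewrite -[LHS]/(u n x - (u M0 x - dv x)) dvE subKr.
apply/cvgrPdist_le => e e0; have [M MP] := key e e0.
exists M => // n /= Mn.
rewrite sub0r normrN ger0_norm ?L2norm_ge0// L2norm_le; last exact: ltW.
rewrite -lee_fin -integral_sqr_L2; under eq_integral do rewrite uv.
exact: MP.
Qed.

End L2_inner_product.
(** * Functional calculus tested against spectral measures *)

Section simple_function_comparison.
Context d (T : measurableType d) (R : realType).
Local Open Scope ereal_scope.
Import HBNNSimple.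

Lemma integral_comp_nnsfun (m : {measure set T -> \bar R}) (g : {nnsfun T >-> R})
    (H : R -> R) : (forall y, 0 <= y -> 0 <= H y)%R -> measurable_fun setT H ->
  \int[m]_x (H (g x))%:E =
  \sum_(y <- fset_set (range g)) (H y)%:E * m (g @^-1` [set y]).
Proof.
move=> H0 mH.
have mg y : measurable (g @^-1` [set y]) by exact: measurable_sfunP.
have cov : \big[setU/set0]_(y <- fset_set (range g)) (g @^-1` [set y]) = setT.
  by rewrite -fsbig_finite// nnsfun_cover.
transitivity (\int[m]_(x in
    \big[setU/set0]_(y <- fset_set (range g)) (g @^-1` [set y])) (H (g x))%:E).
  by rewrite cov.
rewrite ge0_integral_bigsetU//=.
- apply: eq_big_seq => y _.
  rewrite (eq_integral (fun=> (H y)%:E)); last first.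
    by move=> x /set_mem /= ->.
  by rewrite integral_cst.
- exact: trivIset_preimage1.
- by rewrite cov; apply/measurable_EFinP; apply: measurableT_comp.
- by move=> x _; rewrite lee_fin H0.
Qed.

(** For a simple function the hypothesis is used on each level set, with [c] the value taken there:
    the quadratic coefficient becomes [\int phi^2], and the [m4] terms add up to [m4 setT] because
    the level sets partition the space. Monotone convergence extends this to [phi]. *)
Lemma ge0_integral_comparison (m1 m2 m3 m4 : {measure set T -> \bar R}) (phi : T -> R) :
  (forall x, 0 <= phi x)%R -> measurable_fun setT phi ->
  (forall c B, (0 <= c)%R -> measurable B ->
    c%:E * m1 B <= c%:E * m2 B + (c ^+ 2)%:E * m3 B + m4 B) ->
  \int[m1]_x (phi x)%:E <=
    \int[m2]_x (phi x)%:E + \int[m3]_x (phi x ^+ 2)%:E + m4 setT.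
Proof.
move=> phi0 mphi H.
have mphiE : measurable_fun setT (EFin \o phi) by exact/measurable_EFinP.
pose g := nnsfun_approx measurableT mphiE.
have gphi n x : (g n x <= phi x)%R.
  rewrite -lee_fin /g nnsfun_approxE.
  by apply: (@le_approx _ _ _ setT (EFin \o phi)) => // y _; rewrite lee_fin.
have step n : \int[m1]_x (g n x)%:E <=
    \int[m2]_x (phi x)%:E + \int[m3]_x (phi x ^+ 2)%:E + m4 setT.
  apply: (@le_trans _ _ (\int[m2]_x (g n x)%:E + \int[m3]_x (g n x ^+ 2)%:E +
    \int[m4]_x (cst 1%R (g n x))%:E)).
    rewrite (integral_comp_nnsfun m1 (g n) (H := id))// (integral_comp_nnsfun m2 (g n) (H := id))//.
    rewrite (integral_comp_nnsfun m3 (g n) (H := fun y => y ^+ 2)%R)//.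
    rewrite (integral_comp_nnsfun m4 (g n) (H := cst 1%R))//.
    rewrite -!big_split/=; rewrite big_seq [leRHS]big_seq; apply: lee_sum => y.
    rewrite in_fset_set// => /set_mem[x _ <-]; rewrite mul1e; exact: H.
    by move=> y _; rewrite sqr_ge0.
  apply: leeD; last by rewrite (integral_cst m4 measurableT 1) mul1e.
  apply: leeD; apply: ge0_le_integral => //.
  - by move=> x _; rewrite lee_fin.
  - exact/measurable_EFinP.
  - by move=> x _; rewrite lee_fin.
  - by move=> x _; rewrite lee_fin sqr_ge0.
  - exact/measurable_EFinP/measurable_funX.
  - exact/measurable_EFinP/measurable_funX.
  - by move=> x _; rewrite lee_fin ler_sqr ?nnegrE.
have -> : \int[m1]_x (phi x)%:E = limn (fun n => \int[m1]_x (g n x)%:E).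
  rewrite -monotone_convergence//.
  - apply: eq_integral => x _; apply/esym/cvg_lim => //.
    by apply: cvg_nnsfun_approx => // y _; rewrite lee_fin.
  - by move=> n; exact/measurable_EFinP.
  - by move=> n x _; rewrite lee_fin.
  - by move=> x _ a b ab; rewrite lee_fin; exact/lefP/nd_nnsfun_approx.
apply: lime_le; last by apply: nearW => n; exact: step.
apply: ereal_nondecreasing_is_cvgn => a b ab; apply: ge0_le_integral => //.
- by move=> x _; rewrite lee_fin.
- exact/measurable_EFinP.
- exact/measurable_EFinP.
- by move=> x _; rewrite lee_fin; exact/lefP/nd_nnsfun_approx.
Qed.

End simple_function_comparison.

Lemma Rintegral_dominated_cvg d (T : measurableType d) (R : realType)
    (m : {measure set T -> \bar R}) (D : set T) (f_ : nat -> T -> R) (f g : T -> R) :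
  measurable D -> (forall n, measurable_fun D (f_ n)) -> measurable_fun D f ->
  (forall x, D x -> f_ n x @[n --> \oo] --> f x) ->
  m.-integrable D (EFin \o g) -> (forall n x, D x -> `|f_ n x| <= g x) ->
  \int[m]_(x in D) f_ n x @[n --> \oo] --> \int[m]_(x in D) f x.
Proof.
move=> mD mf_ mf f_f ig f_g.
have [int_f _ cv] : [/\ m.-integrable D (EFin \o f),
    (\int[m]_(x in D) `|(f_ n x)%:E - (f x)%:E|)%E @[n --> \oo] --> (0 : \bar R) &
    (\int[m]_(x in D) (f_ n x)%:E)%E @[n --> \oo] --> (\int[m]_(x in D) (f x)%:E)%E].
  apply: dominated_convergence ig _ => //.
  - by move=> n; exact/measurable_EFinP.
  - exact/measurable_EFinP.
  - apply: aeW => x Dx; apply/fine_cvgP; split; first by apply: filterE.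
    exact: f_f.
  - by apply: aeW => x n Dx; rewrite lee_fin; exact: f_g.
apply: fine_cvg; rewrite /Rintegral fineK//; exact: integrable_fin_num.
Qed.

(** * Spectral measures as quadratic forms in the vector *)

Section spectral_measures.
Context d (T : measurableType d) (R : realType) (mu : {measure set T -> \bar R}).
Variable E : projection_measure mu.
Local Notation L2 := (L2 mu).
Local Notation nu := (pm_measure E).
Implicit Types (f g h : L2) (B C : set R) (phi psi : R -> R).

Lemma pm_dot_linear B a f g h : measurable B ->
  L2dot (E B (a *: f + g)) h = a * L2dot (E B f) h + L2dot (E B g) h.
Proof. by move=> mB; rewrite (eq_L2dotl _ (pm_linear E mB a f g)) L2dotDl L2dotZl. Qed.

Lemma pm_dotC B f h : measurable B -> L2dot (E B f) h = L2dot (E B h) f.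
Proof. by move=> mB; rewrite pm_symmetric// L2dotC. Qed.

Lemma pm_measure_fin B h : measurable B -> nu h B \is a fin_num.
Proof. by move=> mB; rewrite pm_measureE. Qed.

Lemma pm_measure_setT h : nu h setT = (L2dot h h)%:E.
Proof. by rewrite pm_measureE//; congr EFin; apply: eq_L2dotl; exact: pm_setT. Qed.

Lemma pm_measure_quadratic B a f h : measurable B ->
  nu (a *: f + h) B =
  (a ^+ 2 * L2dot (E B f) f + 2 * a * L2dot (E B f) h + L2dot (E B h) h)%:E.
Proof.
move=> mB; rewrite pm_measureE// pm_dot_linear// !(L2dotDr, L2dotZr).
by rewrite (pm_dotC h f)//; congr EFin; ring.
Qed.

Lemma pm_measureD B f h : measurable B ->
  nu (f + h) B = (L2dot (E B f) f + 2 * L2dot (E B f) h + L2dot (E B h) h)%:E.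
Proof.
move=> mB; rewrite -[f in LHS]scale1r pm_measure_quadratic//.
by congr EFin; ring.
Qed.

Lemma pm_measureB B f h : measurable B ->
  nu (f - h) B = (L2dot (E B f) f - 2 * L2dot (E B f) h + L2dot (E B h) h)%:E.
Proof.
move=> mB; rewrite addrC -scaleN1r pm_measure_quadratic// (pm_dotC h f)//.
by congr EFin; ring.
Qed.

(** The parallelogram law makes the two left-hand sides add up to the common right-hand side, and
    both are nonnegative. *)
Lemma pm_measureDB_le B f h : measurable B ->
  (nu (f + h)%R B <= 2%:E * nu f B + 2%:E * nu h B)%E /\
  (nu (f - h)%R B <= 2%:E * nu f B + 2%:E * nu h B)%E.
Proof.
move=> mB; have p : (0 <= nu (f + h)%R B)%E by exact: measure_ge0.
have m : (0 <= nu (f - h)%R B)%E by exact: measure_ge0.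
move: p m; rewrite pm_measureD// pm_measureB// !pm_measureE// -!EFinM -!EFinD.
by rewrite !lee_fin; split; lra.
Qed.

(* [0 <= nu (2 c f + h) B] and [0 <= nu (- 2 c f + h) B] *)
Lemma pm_measure_comparison B c f h : measurable B -> 0 <= c ->
  (c%:E * nu (f + h)%R B <=
     c%:E * nu (f - h)%R B + (c ^+ 2)%:E * (4%:E * nu f B) + nu h B)%E /\
  (c%:E * nu (f - h)%R B <=
     c%:E * nu (f + h)%R B + (c ^+ 2)%:E * (4%:E * nu f B) + nu h B)%E.
Proof.
move=> mB c0.
have m : (0 <= nu ((- (2 * c)) *: f + h)%R B)%E by exact: measure_ge0.
have p : (0 <= nu ((2 * c) *: f + h)%R B)%E by exact: measure_ge0.
move: p m; rewrite !pm_measure_quadratic// pm_measureD// pm_measureB// !pm_measureE//.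
rewrite -!EFinM -!EFinD !lee_fin.
by move=> m p; split; lra.
Qed.

Lemma pm_measure_proj B C h : measurable B -> measurable C ->
  nu (E B h) C = nu h (C `&` B).
Proof.
move=> mB mC; have mCB : measurable (C `&` B) by exact: measurableI.
rewrite !pm_measureE//; congr EFin.
rewrite -(eq_L2dotl _ (pm_setI E mC mB h)) L2dotC pm_symmetric//.
rewrite -L2dotC.
have -> : L2dot (E B (E (C `&` B) h)) h = L2dot (E (B `&` (C `&` B)) h) h.
  by apply/esym/eq_L2dotl; exact: pm_setI.
by rewrite setICA setIid.
Qed.

End spectral_measures.

(** * A weak functional calculus for symbols of growth at most [1 + w] *)

Section calculus_with_weight.
Context d (T : measurableType d) (R : realType) (mu : {measure set T -> \bar R}).
Variable E : projection_measure mu.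
Variable w : R -> R.
Hypothesis w_ge0 : forall l, 0 <= w l.
Hypothesis w_meas : measurable_fun setT w.
Local Notation L2 := (L2 mu).
Local Notation nu := (pm_measure E).
Implicit Types (f g h : L2) (phi psi : R -> R).

Definition weight_dom h := (nu h).-integrable setT (EFin \o (fun l => w l ^+ 2)).

Definition dominated phi :=
  measurable_fun setT phi /\ exists M, forall l, `|phi l| <= M * (1 + w l).

(* A weak form of [calculus E phi f g] whose class of test vectors does not
   depend on [phi], so that it is linear in [(phi, g)].  That class is dense: it
   contains the vectors [E (cutoff n) h]. *)
Definition represents f phi g := forall h, weight_dom h ->
  L2dot g h = (\int[nu (f + h)]_l phi l - \int[nu (f - h)]_l phi l) / 4.

Lemma dominatedB phi psi : dominated phi -> dominated psi ->
  dominated (fun l => phi l - psi l).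
Proof.
move=> [mphi [M phiM]] [mpsi [N psiN]]; split; first exact: measurable_funB.
exists (M + N) => l; rewrite mulrDl.
by rewrite (le_trans (ler_normB _ _))// lerD.
Qed.

Lemma pm_integrable_cst h c : (nu h).-integrable setT (cst c%:E).
Proof.
apply/integrableP; split; first exact: measurable_cst.
rewrite (eq_integral (cst `|c|%:E))// integral_cst// pm_measure_setT -EFinM.
exact: ltry.
Qed.

Lemma weight_dom_integrable_sqr h phi : weight_dom h -> dominated phi ->
  (nu h).-integrable setT (EFin \o (fun l => phi l ^+ 2)).
Proof.
move=> wh [mphi [M phiM]].
(* The majorant comes from [(1 + x)^2 <= 2 + 2 x^2]. *)
have i2 : (nu h).-integrable setT (EFin \o (fun l => 2 * M ^+ 2 + 2 * M ^+ 2 * w l ^+ 2)).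
  have i1 := pm_integrable_cst h (2 * M ^+ 2).
  have := integrableD measurableT i1 (integrableZl measurableT (2 * M ^+ 2) wh).
  by apply: eq_integrable => // l _; rewrite /= -EFinM -EFinD.
apply: le_integrable i2 => //; first exact/measurable_EFinP/measurable_funX.
move=> l _ /=; rewrite lee_fin ger0_norm ?sqr_ge0// ger0_norm; last first.
  by have := sqr_ge0 M; have := sqr_ge0 (w l); nra.
have := phiM l; have := w_ge0 l; rewrite -(real_normK (num_real (phi l))).
have := normr_ge0 (phi l); set p := `|phi l|; set x := w l => p0 x0 pM.
have M0 : 0 <= M.
  by rewrite -(pmulr_lge0 (x := 1 + x)) ?(le_trans p0)// ltr_wpDr.
have : p ^+ 2 <= (M * (1 + x)) ^+ 2 by rewrite ler_sqr ?nnegrE// (le_trans p0).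
have : 0 <= M ^+ 2 * (1 - x) ^+ 2 by rewrite mulr_ge0 ?sqr_ge0.
nra.
Qed.

(** The measure [nu h] has finite mass, so [|phi| <= 1 + phi^2] reduces the claim to the square. *)
Lemma weight_dom_integrable h phi : weight_dom h -> dominated phi ->
  (nu h).-integrable setT (EFin \o phi).
Proof.
move=> wh dphi; have i2 := weight_dom_integrable_sqr wh dphi.
have := integrableD measurableT (pm_integrable_cst h 1) i2.
apply: le_integrable => //; first by apply/measurable_EFinP; case: dphi.
move=> l _ /=; rewrite lee_fin [leRHS]ger0_norm; last first.
  by rewrite addr_ge0// sqr_ge0.
rewrite -(real_normK (num_real (phi l))); have := normr_ge0 (phi l); nra.
Qed.

Lemma weight_domDB f h : weight_dom f -> weight_dom h ->
  weight_dom (f + h) /\ weight_dom (f - h).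
Proof.
move=> wf wh.
pose m1 : {measure set R -> \bar R} := measure_add (nu f) (nu f).
pose m2 : {measure set R -> \bar R} := measure_add (nu h) (nu h).
pose m : {measure set R -> \bar R} := measure_add m1 m2.
have mw2 : measurable_fun setT (EFin \o (fun l => w l ^+ 2)).
  exact/measurable_EFinP/measurable_funX.
have im : (\int[m]_l (w l ^+ 2)%:E < +oo)%E.
  have iw k : weight_dom k -> (\int[nu k]_l (w l ^+ 2)%:E < +oo)%E.
    by move=> wk; rewrite -ge0_fin_numE; [exact: integrable_fin_num|
      apply: integral_ge0 => l _; rewrite lee_fin sqr_ge0].
  rewrite !ge0_integral_measure_add//; do ?[by move=> l _; rewrite lee_fin sqr_ge0].
  by apply: lte_add_pinfty; apply: lte_add_pinfty; exact: iw.
have mE B : m B = (2%:E * nu f B + 2%:E * nu h B)%E.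
  rewrite -[LHS]/(measure_add m1 m2 B) measure_addE !(mule_natl _ 2).
  by rewrite -[m1 B]/(measure_add _ _ B) -[m2 B]/(measure_add _ _ B) !measure_addE.
have key k : (forall B, measurable B -> (nu k B <= m B)%E) -> weight_dom k.
  move=> km; apply/integrableP; split => //.
  apply: le_lt_trans im.
  under eq_integral do rewrite /= ger0_norm ?sqr_ge0//.
  apply: ge0_le_measure_integral => //.
  by move=> l; rewrite lee_fin sqr_ge0.
by split; apply: key => B mB; rewrite mE; have [] := pm_measureDB_le E f h mB.
Qed.

Lemma representsB f phi psi g g' : weight_dom f -> dominated phi -> dominated psi ->
  represents f phi g -> represents f psi g' ->
  represents f (fun l => phi l - psi l) (g - g').
Proof.
move=> wf dphi dpsi rg rg' h wh; have [wD wB] := weight_domDB wf wh.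
rewrite L2dotBl rg// rg'// !RintegralB//; try exact: weight_dom_integrable.
by field.
Qed.

Lemma representsZ f phi g c : weight_dom f -> dominated phi ->
  represents f phi g -> represents f (fun l => c * phi l) (c *: g).
Proof.
move=> wf dphi rg h wh; have [wD wB] := weight_domDB wf wh.
rewrite L2dotZl rg// !RintegralZl//; try exact: weight_dom_integrable.
by field.
Qed.

Definition cutoff (n : nat) : set R := [set l | w l <= n%:R].

Lemma measurable_cutoff n : measurable (cutoff n).
Proof.
rewrite (_ : cutoff n = setT `&` w @^-1` `]-oo, n%:R]); last first.
  by apply/seteqP; split => l /=; rewrite in_itv/=; [split|case].
exact: w_meas.
Qed.

(** The spectral measure of [E (cutoff n) h] vanishes off [cutoff n], so [w^2] may be replaced by
    its truncation at [n^2], which is bounded. *)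
Lemma weight_dom_cutoff n h : weight_dom (E (cutoff n) h).
Proof.
have mc := measurable_cutoff n.
have n0 : nu (E (cutoff n) h) (~` cutoff n) = 0%E.
  by rewrite pm_measure_proj//; [rewrite setICl measure0|exact: measurableC].
have mw2 : measurable_fun setT (EFin \o (fun l => w l ^+ 2)).
  exact/measurable_EFinP/measurable_funX.
apply/integrableP; split => //.
have -> : (\int[nu (E (cutoff n) h)]_l `|(EFin \o (fun l => (w l ^+ 2)%R)) l| =
    \int[nu (E (cutoff n) h)]_l (Num.min (w l ^+ 2) (n%:R ^+ 2))%:E)%E.
  apply: ae_eq_integral => //.
  - exact: measurableT_comp.
  - by apply/measurable_EFinP/measurable_minr => //; exact: measurable_funX.
  - exists (~` cutoff n); split => //; first exact: measurableC.
    move=> l /=; apply: contra_not => /= wl _; congr EFin.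
    by rewrite ger0_norm ?sqr_ge0// min_l// ler_sqr ?nnegrE.
apply: (@le_lt_trans _ _ (\int[nu (E (cutoff n) h)]_l (n%:R ^+ 2)%:E)%E).
  apply: ge0_le_integral => //.
  - by move=> l _; rewrite lee_fin le_min !sqr_ge0.
  - by apply/measurable_EFinP/measurable_minr => //; exact: measurable_funX.
  - by move=> l _; rewrite lee_fin ge_min lexx orbT.
by rewrite integral_cst// pm_measure_setT -EFinM ltry.
Qed.

Lemma pm_measure_cutoff_cvg h : nu h (cutoff n) @[n --> \oo] --> nu h setT.
Proof.
have <- : \bigcup_n cutoff n = setT.
  apply/seteqP; split => // l _.
  by exists (Num.truncn (w l)).+1 => //; rewrite /cutoff/= ltW// truncnS_gt.
apply: nondecreasing_cvg_mu.
- by move=> n; exact: measurable_cutoff.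
- by apply: bigcupT_measurable => n; exact: measurable_cutoff.
- move=> m n mn; apply/subsetPset => l; rewrite /cutoff/= => /le_trans; apply.
  by rewrite ler_nat.
Qed.

Lemma EFin_Rintegral (m : {measure set R -> \bar R}) phi :
  m.-integrable setT (EFin \o phi) ->
  ((\int[m]_l phi l)%:E = \int[m]_l (phi l)%:E)%E.
Proof. by move=> ip; rewrite /Rintegral fineK//; exact: integrable_fin_num. Qed.

(** After division by 4 this bounds the polarized pairing of [psi] in absolute value by
    [\int psi^2 + ||h||^2 / 4]: Young's inequality in the role of Cauchy-Schwarz for the signed
    measure [B |-> <E B f, h>]. *)
Lemma pm_Rintegral_comparison f h psi : weight_dom f -> weight_dom h ->
  dominated psi -> (forall l, 0 <= psi l) ->
  \int[nu (f + h)]_l psi l <=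
    \int[nu (f - h)]_l psi l + 4 * \int[nu f]_l psi l ^+ 2 + L2dot h h /\
  \int[nu (f - h)]_l psi l <=
    \int[nu (f + h)]_l psi l + 4 * \int[nu f]_l psi l ^+ 2 + L2dot h h.
Proof.
move=> wf wh dpsi psi0; have [wD wB] := weight_domDB wf wh.
have i2 := weight_dom_integrable_sqr wf dpsi.
have iD := weight_dom_integrable wD dpsi; have iB := weight_dom_integrable wB dpsi.
have mpsi : measurable_fun setT psi by case: dpsi.
have k4P : 0 <= (4 : R) by [].
pose k4 : {nonneg R} := NngNum k4P.
have i4 : (\int[mscale k4 (nu f)]_l (psi l ^+ 2)%:E =
    4%:E * \int[nu f]_l (psi l ^+ 2)%:E)%E.
  apply: ge0_integral_mscale => //.
    exact/measurable_EFinP/measurable_funX.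
  by move=> l _; rewrite lee_fin sqr_ge0.
have toR (a b c e : R) :
    (a%:E <= b%:E + 4%:E * c%:E + e%:E)%E -> a <= b + 4 * c + e.
  by rewrite -EFinM -!EFinD lee_fin.
split; apply: toR; rewrite !EFin_Rintegral// -i4 -(pm_measure_setT E);
  apply: ge0_integral_comparison => // c B c0 mB;
  by have [] := pm_measure_comparison E f h mB c0.
Qed.

(* Testing against [h = E (cutoff n) g] gives [<g, h> = <h, h> = nu g (cutoff n)],
   which the comparison bounds by [2 \int phi^2]. *)
Lemma represents_norm f phi g : weight_dom f -> dominated phi ->
  represents f phi g -> L2dot g g <= 2 * \int[nu f]_l phi l ^+ 2.
Proof.
move=> wf dphi rg.
(* The comparison requires nonnegative symbols; positive and negative parts have disjoint supports,
   so [phi^2 = p^2 + q^2]. Adding the two bounds gives [<g, h> <= \int phi^2 + ||h||^2 / 2]; with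
   [<g, h> = ||h||^2] the last term is absorbed, whence the factor 2. *)
pose p l : R := Num.max (phi l) 0; pose q l : R := Num.max (- phi l) 0.
have dp : dominated p.
  case: dphi => mphi [M phiM]; split; first exact: measurable_maxr.
  exists M => l; apply: le_trans (phiM l).
  by rewrite /p; case: (leP (phi l) 0) => _; rewrite ?normr0.
have dq : dominated q.
  case: dphi => mphi [M phiM]; split.
    by apply: measurable_maxr => //; exact: measurableT_comp.
  exists M => l; apply: le_trans (phiM l); rewrite -(normrN (phi l)).
  by rewrite /q; case: (leP (- phi l) 0) => _; rewrite ?normr0.
have p0 l : 0 <= p l by rewrite /p le_max lexx orbT.
have q0 l : 0 <= q l by rewrite /q le_max lexx orbT.
have phiE : phi = (fun l => p l - q l).
  apply/funext => l; rewrite /p /q; case: (leP (phi l) 0); case: (leP (- phi l) 0); lra.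
have phi2E : (fun l => phi l ^+ 2) = (fun l => p l ^+ 2 + q l ^+ 2).
  by apply/funext => l; rewrite /p /q; case: (leP (phi l) 0); case: (leP (- phi l) 0); nra.
have i2E : \int[nu f]_l phi l ^+ 2 =
    \int[nu f]_l p l ^+ 2 + \int[nu f]_l q l ^+ 2.
  by rewrite phi2E RintegralD//; exact: weight_dom_integrable_sqr.
have key n : (nu g (cutoff n) <= (2 * \int[nu f]_l phi l ^+ 2)%:E)%E.
  have mc := measurable_cutoff n.
  pose h := E (cutoff n) g; have wh : weight_dom h := weight_dom_cutoff n g.
  have gh : (L2dot g h)%:E = nu g (cutoff n).
    by rewrite L2dotC pm_measureE.
  have hh : L2dot h h = L2dot g h.
    by apply: EFin_inj; rewrite -(pm_measure_setT E) gh pm_measure_proj// setTI.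
  have [wD wB] := weight_domDB wf wh.
  have [+ _] := pm_Rintegral_comparison wf wh dp p0.
  have [_] := pm_Rintegral_comparison wf wh dq q0.
  have := rg h wh; rewrite hh -gh lee_fin i2E phiE.
  rewrite !RintegralB//; try exact: weight_dom_integrable.
  lra.
have cv := pm_measure_cutoff_cvg (h := g).
rewrite -lee_fin -(pm_measure_setT E) -(cvg_lim _ cv)//.
by apply: lime_le; [apply/cvg_ex; eexists; exact: cv|exact: nearW].
Qed.

Section sequences.
Variables (f : L2) (M : R) (phi_ : nat -> R -> R) (phi : R -> R).
Hypothesis wf : weight_dom f.
Hypothesis mphi_ : forall n, measurable_fun setT (phi_ n).
Hypothesis mphi : measurable_fun setT phi.
Hypothesis phi_M : forall n l, `|phi_ n l| <= M * (1 + w l).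
Hypothesis phiM : forall l, `|phi l| <= M * (1 + w l).
Hypothesis phi_cvg : forall l, phi_ n l @[n --> \oo] --> phi l.

Lemma dominated_seq n : dominated (phi_ n).
Proof. by split => //; exists M. Qed.

Lemma dominated_lim : dominated phi.
Proof. by split => //; exists M. Qed.

Lemma pm_Rintegral_cvg k : weight_dom k ->
  \int[nu k]_l phi_ n l @[n --> \oo] --> \int[nu k]_l phi l.
Proof.
move=> wk.
have i1 : (nu k).-integrable setT (EFin \o (fun l => M * (1 + w l))).
  have := weight_dom_integrable (phi := fun l => M * (1 + w l)) wk; apply.
  split; first by apply: measurable_funM => //; exact: measurable_funD.
  exists `|M| => l; rewrite normrM [X in _ * X]ger0_norm// addr_ge0//.
apply: (Rintegral_dominated_cvg measurableT _ _ _ i1) => // l _; exact: phi_cvg.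
Qed.

Lemma pm_sqr_dist_cvg0 :
  \int[nu f]_l (phi_ n l - phi l) ^+ 2 @[n --> \oo] --> (0 : R).
Proof.
have i1 : (nu f).-integrable setT (EFin \o (fun l => (2 * M * (1 + w l)) ^+ 2)).
  apply: weight_dom_integrable_sqr wf _.
  split; first by apply: measurable_funM => //; exact: measurable_funD.
  by exists `|2 * M| => l; rewrite normrM [X in _ * X]ger0_norm// addr_ge0.
have -> : (0 : R) = \int[nu f]_l (fun=> 0) l by rewrite Rintegral_cst// mul0r.
apply: (Rintegral_dominated_cvg measurableT _ _ _ i1) => //.
- by move=> n; apply: measurable_funX; exact: measurable_funB.
- move=> l _; have -> : (0 : R) = (phi l - phi l) ^+ 2 by rewrite subrr expr0n.
  apply: (@cvg_comp _ _ _ (fun n => phi_ n l - phi l) (fun z => z ^+ 2)).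
    by apply: cvgB; [exact: phi_cvg|exact: cvg_cst].
  exact: exprn_continuous.
- move=> n l _; rewrite ger0_norm ?sqr_ge0// -(real_normK (num_real (phi_ n l - phi l))).
  rewrite ler_sqr ?nnegrE; last 2 first.
  + exact: normr_ge0.
  + rewrite (le_trans (normr_ge0 (phi_ n l - phi l)))//.
    by rewrite (le_trans (ler_normB _ _))// -mulrA mulr2n mulrDl !mul1r lerD.
  by rewrite (le_trans (ler_normB _ _))// -mulrA mulr2n mulrDl !mul1r lerD.
Qed.

(** The vector [g_ n - g] represents [phi_ n - phi], so [represents_norm] turns dominated
    convergence for the spectral measure of [f] into norm convergence. *)
Lemma represents_cvg (g_ : nat -> L2) g : (forall n, represents f (phi_ n) (g_ n)) ->
  represents f phi g -> L2cvg \oo g_ g.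
Proof.
move=> rg_ rg; apply/cvgrPdist_lt => e e0.
have e2 : 0 < e ^+ 2 / 2 by rewrite divr_gt0// exprn_gt0.
have /cvgr0_norm_lt/(_ _ e2) := pm_sqr_dist_cvg0.
apply: filterS => n lt; rewrite sub0r normrN ger0_norm ?L2norm_ge0//.
rewrite -ltr_sqr ?nnegrE ?L2norm_ge0 ?ltW// L2norm_sqr.
have dn := dominated_seq n; have dl := dominated_lim.
apply: le_lt_trans (represents_norm wf (dominatedB dn dl) (representsB wf dn dl (rg_ n) rg)) _.
by rewrite mulrC -ltr_pdivlMr// (le_lt_trans (ler_norm _)).
Qed.

(** No vector is given in advance for the limit symbol. The [g_ n] form a Cauchy sequence by
    [represents_norm], and the weak identity passes to the limit on both sides for each fixed test
    vector. *)
Lemma represents_lim (g_ : nat -> L2) : (forall n, represents f (phi_ n) (g_ n)) ->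
  exists g, represents f phi g.
Proof.
move=> rg_.
have [g gP] : exists g, L2cvg \oo g_ g.
  apply: L2_complete => e e0.
  (* The 8 collects the factor 2 of [represents_norm], the factor 2 of [(a - b)^2 <= 2 a^2 + 2 b^2],
     and the two terms. *)
  have e2 : 0 < e ^+ 2 / 8 by rewrite divr_gt0// exprn_gt0.
  have /cvgr0_norm_lt/(_ _ e2)[N _ NP] := pm_sqr_dist_cvg0.
  exists N => m n Nm Nn.
  rewrite -ltr_sqr ?nnegrE ?L2norm_ge0 ?ltW// L2norm_sqr.
  have dm := dominated_seq m; have dn := dominated_seq n; have dl := dominated_lim.
  have im := weight_dom_integrable_sqr wf (dominatedB dm dl).
  have in' := weight_dom_integrable_sqr wf (dominatedB dn dl).
  apply: le_lt_trans (represents_norm wf (dominatedB dm dn)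
    (representsB wf dm dn (rg_ m) (rg_ n))) _.
  have : \int[nu f]_l (phi_ m l - phi_ n l) ^+ 2 <=
      \int[nu f]_l (2 * (phi_ m l - phi l) ^+ 2 + 2 * (phi_ n l - phi l) ^+ 2).
    apply: le_Rintegral => //.
    - exact: weight_dom_integrable_sqr wf (dominatedB dm dn).
    - have := integrableD measurableT (integrableZl measurableT 2 im)
        (integrableZl measurableT 2 in').
      by apply: eq_integrable => // l _.
    - move=> l _; have := sqr_ge0 (phi_ m l - phi l + (phi_ n l - phi l)); nra.
  rewrite RintegralD//; last 2 first.
    by have := integrableZl measurableT 2 im; apply: eq_integrable.
    by have := integrableZl measurableT 2 in'; apply: eq_integrable.
  rewrite !RintegralZl//.
  have := NP m Nm; have := NP n Nn => /=.
  rewrite !ger0_norm; [lra| |]; by apply: Rintegral_ge0 => l _; rewrite sqr_ge0.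
exists g => h wh; have [wD wB] := weight_domDB wf wh.
have cl : L2dot (g_ n) h @[n --> \oo] --> L2dot g h by exact: L2cvg_dot.
have cr : (\int[nu (f + h)]_l phi_ n l - \int[nu (f - h)]_l phi_ n l) / 4 @[n --> \oo]
    --> (\int[nu (f + h)]_l phi l - \int[nu (f - h)]_l phi l) / 4.
  by apply: cvgMl; apply: cvgB; exact: pm_Rintegral_cvg.
rewrite -(cvg_lim _ cl)//; under eq_fun do rewrite rg_//.
exact: cvg_lim.
Qed.

End sequences.
End calculus_with_weight.
(** * Bessel-type integrals on the half-line *)

Section calculus_on_the_half_line.
Context {R : realType}.
Local Notation leb := (@lebesgue_measure R).
Local Notation Rp := (`]0, +oo[%classic : set R).
Implicit Types (x y c p s t u w : R).

Lemma is_derive_continuous (f : R -> R) x df :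
  is_derive x 1 f df -> {for x, continuous f}.
Proof.
by move=> [dfx _]; apply: differentiable_continuous; exact/derivable1_diffP.
Qed.

Lemma is_derive_cdivx c x : x != 0 ->
  is_derive x 1 (fun t : R => c / t) (- (c / x ^+ 2)).
Proof.
move=> x0; apply: is_derive_eq.
  by apply: is_deriveM; apply: is_deriveV.
by rewrite /GRing.scale/= mulr1 mulr0 addr0 mulrN.
Qed.

(** The factor [c] at the upper end makes each of these intervals invariant under the inversion
    [t -> c / t], which exchanges its endpoints. *)
Lemma itv_exhaust_bigcup c : 0 < c ->
  \bigcup_n `[n.+1%:R^-1, c * n.+1%:R]%classic = Rp.
Proof.
move=> c0; apply/seteqP; split=> x /=.
  by move=> [n _]; rewrite /= !in_itv/= andbT => /andP[+ _]; apply: lt_le_trans.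
rewrite in_itv/= andbT => x0.
pose n := Num.truncn (Num.max x^-1 (x / c)).
exists n => //=; rewrite in_itv/=.
have := truncnS_gt (Num.max x^-1 (x / c)); rewrite -/n gt_max => /andP[h1 h2].
rewrite -lef_pV2 ?posrE ?invr_gt0// invrK ltW//=.
by rewrite mulrC -ler_pdivrMr// ltW.
Qed.

Lemma itv_exhaust_nondecreasing c : 0 < c ->
  nondecreasing_seq (fun n => `[n.+1%:R^-1, c * n.+1%:R]%classic : set R).
Proof.
move=> c0 m n mn; apply/subsetPset => x /=; rewrite !in_itv/= => /andP[a b].
apply/andP; split.
  by rewrite (le_trans _ a)// lef_pV2 ?posrE// ler_nat ltnS.
by rewrite (le_trans b)// ler_pM2l// ler_nat ltnS.
Qed.

Lemma derive1_cdivx c x : x != 0 -> (fun t : R => c / t)^`()%classic x = - (c / x ^+ 2).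
Proof. by move=> x0; rewrite derive1E; have [_ ->] := is_derive_cdivx c x0. Qed.

Lemma continuous_cdivx c x : 0 < x -> {for x, continuous (fun t : R => c / t)}.
Proof. by move=> x0; exact: is_derive_continuous (is_derive_cdivx c (lt0r_neq0 x0)). Qed.

Lemma continuous_derive1_cdivx c x : 0 < x ->
  {for x, continuous (fun t : R => c / t)^`()%classic}.
Proof.
move=> x0; rewrite /prop_for /continuous_at derive1_cdivx ?gt_eqF//.
apply: (@cvg_trans _ ((fun t : R => - (c / t ^+ 2)) @ x)).
  apply: near_eq_cvg; near=> t; rewrite derive1_cdivx// gt_eqF//.
  by near: t; exact: lt_nbhsr.
change ((fun t : R => - (c / t ^+ 2)) @ x --> - (c / x ^+ 2)).
apply: cvgN; apply: cvgMr; apply: cvgV; first by rewrite expf_neq0// gt_eqF.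
exact: exprn_continuous.
Unshelve. all: by end_near. Qed.

Lemma continuous_measurable_Rp (H : R -> R) :
  (forall x, 0 < x -> {for x, continuous H}) -> measurable_fun Rp H.
Proof.
move=> cH; apply: open_continuous_measurable_fun => //.
by move=> x /set_mem; rewrite /= in_itv/= andbT => /cH.
Qed.

Lemma ge0_integral_exhaust_cvg c (H : R -> R) : 0 < c ->
  (forall x, 0 < x -> {for x, continuous H}) -> (forall x, 0 < x -> 0 <= H x) ->
  (\int[leb]_(x in `[n.+1%:R^-1%R, (c * n.+1%:R)%R]) (H x)%:E)%E @[n --> \oo] -->
  (\int[leb]_(x in Rp) (H x)%:E)%E.
Proof.
move=> c0 cH H0; rewrite -(itv_exhaust_bigcup c0).
have itv_gt0 n x : `[n.+1%:R^-1, c * n.+1%:R]%classic x -> 0 < x.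
  by rewrite /= in_itv/= => /andP[+ _]; apply: lt_le_trans.
apply: ge0_nondecreasing_set_cvg_integral => //.
- exact: itv_exhaust_nondecreasing.
- move=> n; apply/measurable_EFinP.
  apply: measurable_funS (continuous_measurable_Rp cH) => //.
  by move=> x /(@itv_gt0 n) x0; rewrite /= in_itv/= x0.
- by move=> n x /(@itv_gt0 n) x0; rewrite lee_fin H0.
Qed.

(** Substitution on the invariant compact intervals, where everything is continuous, followed by
    monotone convergence of both sides; no integrability of [G] is involved. *)
Lemma ge0_integral_inversion c (G : R -> R) : 0 < c ->
  (forall x, 0 < x -> {for x, continuous G}) -> (forall x, 0 < x -> 0 <= G x) ->
  (\int[leb]_(x in Rp) (G x)%:E =
   \int[leb]_(x in Rp) (G (c / x) * (c / x ^+ 2))%:E)%E.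
Proof.
move=> c0 cG G0.
pose F (t : R) := c / t.
pose I n : set R := `[n.+1%:R^-1, c * n.+1%:R]%classic.
have itv_gt0 n x : I n x -> 0 < x.
  by rewrite /I /= in_itv/= => /andP[+ _]; apply: lt_le_trans.
have eqn n : (\int[leb]_(x in I n) (G x)%:E =
    \int[leb]_(x in I n) (G (c / x) * (c / x ^+ 2))%:E)%E.
  rewrite /I; set a := n.+1%:R^-1; set b := c * n.+1%:R.
  have a0 : 0 < a by rewrite invr_gt0.
  have b0 : 0 < b by rewrite mulr_gt0.
  (* For small [c] the first intervals may be empty. *)
  have [ba|ab] := ltP b a.
    by rewrite set_itv_ge ?integral_set0// -leNgt bnd_simp.
  have Fa : F a = b by rewrite /F /a invrK.
  have Fb : F b = a by rewrite /F /b /a invfM mulrA mulfV ?gt_eqF// mul1r.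
  rewrite -{1}Fa -{1}Fb integration_by_substitution_decreasing//.
  - apply: eq_integral => x /set_mem /(@itv_gt0 n) x0.
    by congr EFin; rewrite -[LHS]/(G (F x) * - F^`()%classic x) derive1_cdivx ?gt_eqF// opprK.
  - move=> x y; rewrite !in_itv/= => /andP[ax _] /andP[ay _] yx.
    rewrite /F ltr_pM2l// ltf_pV2// posrE ?(lt_le_trans a0)//.
  - move=> x; rewrite in_itv/= => /andP[ax _].
    by apply: continuous_derive1_cdivx; exact: lt_trans ax.
  - apply: cvgP; apply: cvg_at_right_filter; exact: continuous_derive1_cdivx.
  - apply: cvgP; apply: cvg_at_left_filter; exact: continuous_derive1_cdivx.
  - split.
    + move=> x; rewrite in_itv/= => /andP[ax _].
      have x0 : x != 0 by rewrite gt_eqF// (lt_trans a0).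
      by have [] := is_derive_cdivx c x0.
    + by apply: cvg_at_right_filter; exact: continuous_cdivx.
    + by apply: cvg_at_left_filter; exact: continuous_cdivx.
  - apply: continuous_in_subspaceT => x /set_mem; rewrite Fa Fb => /(@itv_gt0 n) x0.
    exact: cG.
have cG' x : 0 < x -> {for x, continuous (fun x : R => G (c / x) * (c / x ^+ 2))}.
  move=> x0; apply: cvgM.
    apply: (@cvg_comp _ _ _ (fun t : R => c / t) G); first exact: continuous_cdivx.
    by apply: cG; rewrite divr_gt0.
  apply: cvgMr; apply: cvgV; first by rewrite expf_neq0// gt_eqF.
  exact: exprn_continuous.
have l1 := ge0_integral_exhaust_cvg c0 cG G0.
have l2 : (\int[leb]_(x in I n) (G x)%:E)%E @[n --> \oo] -->
    (\int[leb]_(x in Rp) (G (c / x) * (c / x ^+ 2))%:E)%E.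
  under eq_fun do rewrite eqn; apply: ge0_integral_exhaust_cvg => // x x0.
  by rewrite mulr_ge0 ?G0 ?divr_ge0 ?divr_gt0 ?sqr_ge0 ?ltW.
by rewrite -(cvg_lim _ l1)// -(cvg_lim _ l2).
Qed.

(** * The Gamma density and the Bessel-type integrals [K_p] *)

Definition gamma_density p (t : R) := t `^ (p - 1) * expR (- t).

Lemma gamma_density_ge0 p t : 0 <= gamma_density p t.
Proof. by rewrite mulr_ge0 ?powR_ge0 ?expR_ge0. Qed.

Lemma continuous_powR p x : 0 < x -> {for x, continuous (fun t : R => t `^ p)}.
Proof. by move=> x0; exact: is_derive_continuous (is_derive1_powR _ x0). Qed.

Lemma continuous_gamma_density p x : 0 < x -> {for x, continuous (gamma_density p)}.
Proof.
move=> x0; apply: cvgM; first exact: continuous_powR.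
apply: (@cvg_comp _ _ _ (fun t : R => - t) expR); last exact: continuous_expR.
by apply: cvgN; exact: cvg_id.
Qed.

Lemma powR_le1D p x : 0 < x -> 0 <= p <= 1 -> x `^ p <= 1 + x.
Proof.
move=> x0 /andP[p0 p1]; have [x1|x1] := leP x 1.
  apply: (@le_trans _ _ 1); last by rewrite lerDl ltW.
  by have := ge0_ler_powR p0 (ltW x0) ler01 x1; rewrite powR1.
apply: (@le_trans _ _ x); last by rewrite lerDr.
by apply: ler1_powR => //; exact: ltW.
Qed.

(** The chain [1 + x^p <= 2 + x <= 2 exp(x/2)], squared. The majorant is shaped so that its product
    with [x^(p-1)] has an elementary primitive. *)
Lemma expRN_le_sqr x p : 0 < x -> 0 <= p <= 1 ->
  expR (- x) <= 4 / (1 + x `^ p) ^+ 2.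
Proof.
move=> x0 p01; have p0 : 0 < 1 + x `^ p by rewrite ltr_wpDr ?powR_ge0.
rewrite ler_pdivlMr ?exprn_gt0// expRN mulrC ler_pdivrMr ?expR_gt0//.
have h1 := powR_le1D x0 p01.
have h2 : 1 + x / 2 <= expR (x / 2) by exact: expR_ge1Dx.
have h3 : expR x = expR (x / 2) ^+ 2 by rewrite expr2 -expRD -splitr.
rewrite h3; apply: (@le_trans _ _ (4 * (1 + x / 2) ^+ 2)).
  have -> : 4 * (1 + x / 2) ^+ 2 = (2 + x) ^+ 2 by field.
  by rewrite ler_sqr ?nnegrE; lra.
by rewrite ler_wpM2l// ler_sqr ?nnegrE ?expR_ge0// addr_ge0 ?divr_ge0 ?ltW.
Qed.

(* [t^(p-1) / (1 + t^p)^2] has the bounded primitive [- 1 / (p (1 + t^p))]. *)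
Lemma gamma_density_integrable p : 0 < p <= 1 ->
  leb.-integrable Rp (EFin \o gamma_density p).
Proof.
move=> /andP[p0 p1].
pose F (t : R) := - (1 + t `^ p)^-1.
pose dF (t : R) := p * t `^ (p - 1) / (1 + t `^ p) ^+ 2.
have den0 x : 0 < 1 + x `^ p by rewrite ltr_wpDr ?powR_ge0.
have dFP x : 0 < x -> is_derive x 1 F (dF x).
  move=> x0; have dp := is_derive1_powR p x0.
  apply: is_derive_eq.
    by apply: is_deriveN; apply: is_deriveV; rewrite gt_eqF.
  by rewrite /dF /GRing.scale/= add0r mul1r mulNr opprK mulrC.
have cdF x : 0 < x -> {for x, continuous dF}.
  move=> x0; apply: cvgM.
    by apply: cvgMr; exact: continuous_powR.
  apply: cvgV; first by rewrite expf_neq0// gt_eqF.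
  apply: (@cvg_comp _ _ _ (fun t : R => 1 + t `^ p) (fun z => z ^+ 2));
    last exact: exprn_continuous.
  by apply: cvgD; [exact: cvg_cst|exact: continuous_powR].
have dF0 x : 0 < x -> 0 <= dF x.
  by move=> x0; rewrite divr_ge0 ?sqr_ge0// mulr_ge0 ?powR_ge0 ?ltW.
have F01 x : -1 <= F x <= 0.
  rewrite /F lerN2 oppr_le0 invr_ge0 (ltW (den0 x)) andbT.
  by rewrite invf_le1// lerDl powR_ge0.
have intF : (\int[leb]_(x in Rp) (dF x)%:E <= 1%:E)%E.
  have cv := ge0_integral_exhaust_cvg ltr01 cdF dF0.
  rewrite -(cvg_lim _ cv)//; apply: lime_le; first by apply/cvg_ex; eexists; exact: cv.
  apply: nearW => n; set a := n.+1%:R^-1; set b := 1 * n.+1%:R.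
  have a0 : 0 < a by rewrite invr_gt0.
  have [ab|] := ltP a b; last first.
    rewrite le_eqVlt => /predU1P[->|ba]; first by rewrite set_itv1 integral_set1 lee_fin.
    by rewrite set_itv_ge ?integral_set0 ?lee_fin// -leNgt bnd_simp.
  rewrite (@continuous_FTC2 _ dF F)//.
  - rewrite -EFinB lee_fin; have := F01 a; have := F01 b; lra.
  - apply: continuous_in_subspaceT => x /set_mem; rewrite /= in_itv/= => /andP[ax _].
    by apply: cdF; exact: lt_le_trans ax.
  - split.
    + move=> x; rewrite in_itv/= => /andP[ax _].
      by have [] := dFP x (lt_trans a0 ax).
    + by apply: cvg_at_right_filter; exact: is_derive_continuous (dFP a a0).
    + by apply: cvg_at_left_filter; exact: is_derive_continuous (dFP b (lt_trans a0 ab)).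
  - move=> x; rewrite in_itv/= => /andP[ax _]; rewrite derive1E.
    by have [_ ->] := dFP x (lt_trans a0 ax).
have mdF : measurable_fun Rp dF by exact: continuous_measurable_Rp.
have iF : leb.-integrable Rp (EFin \o dF).
  apply/integrableP; split; first exact/measurable_EFinP.
  rewrite (@le_lt_trans _ _ 1%:E) ?ltry//; apply: le_trans intF.
  rewrite le_eqVlt; apply/orP; left; apply/eqP; apply: eq_integral => x /set_mem.
  by rewrite /= in_itv/= andbT => x0; rewrite ger0_norm ?dF0.
have : leb.-integrable Rp (fun x => (4 / p)%:E * (EFin \o dF) x)%E.
  by apply: integrableZl.
apply: le_integrable => //.
  by apply/measurable_EFinP; apply: continuous_measurable_Rp => x; exact: continuous_gamma_density.
move=> x; rewrite /= in_itv/= andbT => x0.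
rewrite lee_fin ger0_norm ?gamma_density_ge0// ger0_norm; last first.
  by rewrite mulr_ge0 ?dF0 ?divr_ge0// ltW.
have -> : 4 / p * dF x = x `^ (p - 1) * (4 / (1 + x `^ p) ^+ 2).
  by rewrite /dF; field; rewrite !gt_eqF.
by rewrite ler_wpM2l ?powR_ge0// expRN_le_sqr// p1 ltW.
Qed.

Definition bessel_density p w (t : R) := expR (- (w / t)) * gamma_density p t.

Definition bessel p w := \int[leb]_(t in Rp) bessel_density p w t.

Lemma in_Rp x : Rp x -> 0 < x.
Proof. by rewrite /= in_itv/= andbT. Qed.

Lemma bessel_density_ge0 p w t : 0 <= bessel_density p w t.
Proof. by rewrite mulr_ge0 ?expR_ge0 ?gamma_density_ge0. Qed.

Lemma bessel_density_le p w t : 0 <= w -> 0 < t ->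
  bessel_density p w t <= gamma_density p t.
Proof.
move=> w0 t0; rewrite -[leRHS]mul1r ler_wpM2r ?gamma_density_ge0//.
by rewrite -expR0 ler_expR oppr_le0 divr_ge0// ltW.
Qed.

Lemma continuous_bessel_density p w x : 0 < x ->
  {for x, continuous (bessel_density p w)}.
Proof.
move=> x0; apply: cvgM; last exact: continuous_gamma_density.
apply: (@cvg_comp _ _ _ (fun t : R => - (w / t)) expR); last exact: continuous_expR.
by apply: cvgN; exact: continuous_cdivx.
Qed.

Lemma measurable_bessel_density p w : measurable_fun Rp (bessel_density p w).
Proof. by apply: continuous_measurable_Rp => x; exact: continuous_bessel_density. Qed.

Lemma bessel_density_integrable p w : 0 < p <= 1 -> 0 <= w ->
  leb.-integrable Rp (EFin \o bessel_density p w).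
Proof.
move=> p01 w0; apply: le_integrable (gamma_density_integrable p01) => //.
  by apply/measurable_EFinP; exact: measurable_bessel_density.
move=> x /in_Rp x0; rewrite lee_fin !ger0_norm ?gamma_density_ge0 ?bessel_density_ge0//.
exact: bessel_density_le.
Qed.

Lemma bessel_densityB1 p w t : 0 < t ->
  bessel_density (p - 1) w t = bessel_density p w t / t.
Proof.
move=> t0; rewrite /bessel_density /gamma_density.
rewrite (@powRB _ t (p - 1) 1) ?powRr1 ?ltW//; first by ring.
by rewrite (gt_eqF t0) implybT.
Qed.

(** Since [exp(w/t) >= 1 + w/t >= u/t], the exponential absorbs the extra factor [1/t], uniformly
    for [w >= u]. This yields integrability at order [p - 1 <= 0] and the majorant for
    differentiation in [w]. *)
Lemma bessel_densityB1_le p w u t : 0 < u -> u <= w -> 0 < t ->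
  bessel_density (p - 1) w t <= u^-1 * gamma_density p t.
Proof.
move=> u0 uw t0; rewrite bessel_densityB1// /bessel_density mulrAC.
rewrite ler_wpM2r ?gamma_density_ge0//.
rewrite ler_pdivrMr// expRN mulrC -[X in _ <= X]invrK invfM invrK.
rewrite lef_pV2 ?posrE ?expR_gt0 ?mulr_gt0 ?invr_gt0//.
apply: le_trans (expR_ge1Dx _); rewrite ler_wpDl// mulrC.
by rewrite ler_pM2r ?invr_gt0.
Qed.

Lemma bessel_densityB1_integrable p w : 0 < p <= 1 -> 0 < w ->
  leb.-integrable Rp (EFin \o bessel_density (p - 1) w).
Proof.
move=> p01 w0.
have : leb.-integrable Rp (fun x => (w^-1)%:E * (EFin \o gamma_density p) x)%E.
  by apply: integrableZl => //; exact: gamma_density_integrable.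
apply: le_integrable => //.
  by apply/measurable_EFinP; exact: measurable_bessel_density.
move=> x /in_Rp x0; rewrite lee_fin !ger0_norm ?bessel_density_ge0//.
  exact: bessel_densityB1_le.
by rewrite mulr_ge0 ?gamma_density_ge0// invr_ge0 ltW.
Qed.

Lemma bessel_ge0 p w : 0 <= bessel p w.
Proof. by apply: Rintegral_ge0 => x _; exact: bessel_density_ge0. Qed.

Lemma bessel0 p : bessel p 0 = Gamma p.
Proof. by apply: eq_Rintegral => x _; rewrite /bessel_density mul0r oppr0 expR0 mul1r. Qed.

Lemma bessel_le p w : 0 < p <= 1 -> 0 <= w -> bessel p w <= Gamma p.
Proof.
move=> p01 w0; rewrite -bessel0; apply: le_Rintegral => //.
- exact: bessel_density_integrable.
- exact: bessel_density_integrable.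
- move=> x /in_Rp x0.
  by rewrite [leRHS]/bessel_density mul0r oppr0 expR0 mul1r bessel_density_le.
Qed.

(** For [p <= 1] neither factor of the density increases, so on [[1, 2]] it is at least its value at
    2. *)
Lemma Gamma_gt0 p : 0 < p <= 1 -> 0 < Gamma p.
Proof.
move=> p01; have ig := gamma_density_integrable p01.
pose c : R := 2 `^ (p - 1) * expR (- 2).
have c0 : 0 < c by rewrite mulr_gt0 ?powR_gt0 ?expR_gt0.
suff : (c%:E <= (Gamma p)%:E)%E by rewrite lee_fin; exact: lt_le_trans.
rewrite /Gamma /Rintegral fineK; last exact: integrable_fin_num.
have sub : `[1, 2]%classic `<=` Rp.
  by move=> x; rewrite /= !in_itv/= andbT => /andP[+ _]; apply: lt_le_trans.
have mg : measurable_fun Rp (EFin \o gamma_density p).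
  by case/integrableP : ig.
apply: (@le_trans _ _ (\int[leb]_(x in `[1%R, 2%R]) (gamma_density p x)%:E)%E).
  apply: (@le_trans _ _ (\int[leb]_(x in `[1%R, 2%R]) c%:E)%E).
    rewrite integral_cst//= lebesgue_measure_itv/= lte_fin ltr1n -EFinB -EFinM lee_fin.
    by rewrite -[X in _ <= _ * X]/((2 - 1)%R) (_ : 2 - 1 = 1) ?mulr1//; ring.
  apply: ge0_le_integral => //.
  - by move=> x _; rewrite lee_fin ltW.
  - exact: measurable_funS mg.
  - move=> x; rewrite /= in_itv/= => /andP[x1 x2]; rewrite lee_fin.
    have x0 : 0 < x by rewrite (lt_le_trans ltr01).
    apply: ler_pM; rewrite ?powR_ge0 ?expR_ge0 ?ler_expR ?lerN2//.
    rewrite -opprB !powRN lef_pV2 ?posrE ?powR_gt0//.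
    have p1 : 0 <= 1 - p by rewrite subr_ge0; case/andP : p01.
    exact: (ge0_ler_powR p1 (ltW x0) (ler0n _ 2) x2).
apply: ge0_subset_integral => //.
by move=> x _; rewrite lee_fin gamma_density_ge0.
Qed.

(** Differentiation under the integral on []w/2, 2w[], which stays away from 0, where the majorant
    blows up. *)
Lemma is_derive_bessel p w : 0 < p <= 1 -> 0 < w ->
  is_derive w 1 (bessel p) (- bessel (p - 1) w).
Proof.
move=> p01 w0.
pose u := w / 2; have u0 : 0 < u by rewrite divr_gt0.
have uE x : `]u, 2 * w[%classic x -> u < x by rewrite /= in_itv/= => /andP[].
have wI : `]u, 2 * w[%classic w.
  by rewrite /= in_itv/= /u; apply/andP; split; lra.
have d1 x t : u < x -> 0 < t ->
    is_derive x 1 (fun x => bessel_density p x t) (- bessel_density (p - 1) x t).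
  move=> ux t0; apply: is_derive_eq.
  rewrite bessel_densityB1// /bessel_density /GRing.scale/=.
  by ring.
pose G t := u^-1 * gamma_density p t.
have intf x : `]u, 2 * w[%classic x -> leb.-integrable Rp (EFin \o bessel_density p x).
  by move=> /uE ux; apply: bessel_density_integrable => //; rewrite ltW// (lt_trans u0).
have derf x t : `]u, 2 * w[%classic x -> Rp t ->
    derivable (fun x => bessel_density p x t) x 1.
  by move=> /uE ux /in_Rp t0; have [] := d1 x t ux t0.
have G0 t : 0 <= G t by rewrite mulr_ge0 ?gamma_density_ge0// invr_ge0 ltW.
have intG : leb.-integrable Rp (EFin \o G).
  have : leb.-integrable Rp (fun x => (u^-1)%:E * (EFin \o gamma_density p) x)%E.
    by apply: integrableZl => //; exact: gamma_density_integrable.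
  by apply: eq_integrable.
have d1E x t : u < x -> 0 < t ->
    partial1of2 (bessel_density p) x t = - bessel_density (p - 1) x t.
  by move=> ux t0; rewrite partial1of2E; have [_ ->] := d1 x t ux t0.
have Gub x t : `]u, 2 * w[%classic x -> Rp t -> `|partial1of2 (bessel_density p) x t| <= G t.
  move=> /uE ux /in_Rp t0; rewrite d1E// normrN ger0_norm ?bessel_density_ge0//.
  by apply: bessel_densityB1_le => //; exact: ltW.
have mRp : measurable (Rp : set (measurableTypeR R)) by exact: measurable_itv.
constructor.
  exact: (derivable_under_integral mRp wI intf derf G0 intG Gub).
rewrite -derive1E (differentiation_under_integral mRp wI intf derf G0 intG Gub).
transitivity (\int[leb]_(t in Rp) (-1 * bessel_density (p - 1) w t)).
  apply: eq_Rintegral => t /set_mem /in_Rp t0.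
  by rewrite mulN1r d1E// (uE _ wI).
by rewrite RintegralZl ?mulN1r//; exact: bessel_densityB1_integrable.
Qed.

Lemma powR_expR (x r : R) : 0 < x -> x `^ r = expR (r * ln x).
Proof. by move=> x0; rewrite /powR gt_eqF. Qed.

(** Under [t = c / x] the measure [t^(r-1) dt] becomes [c^r x^(-1-r) dx]: the origin of the power
    [t^(1+s)] in the Poisson kernel. *)
Lemma powR_cdivx c x (r : R) : 0 < c -> 0 < x ->
  (c / x) `^ (r - 1) * (c / x ^+ 2) = c `^ r / x `^ (1 + r).
Proof.
move=> c0 x0; have cx0 : 0 < c / x by rewrite divr_gt0.
rewrite !powR_expR// ln_div ?posrE//.
have -> : c / x ^+ 2 = expR (ln c - 2 * ln x).
  rewrite expRD expRN lnK ?posrE//; congr (_ / _).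
  by rewrite -[2]/(2%:R) expRM_natl lnK ?posrE.
by rewrite -expRN -!expRD; congr expR; ring.
Qed.

Lemma EFin_bessel p w : 0 < p <= 1 -> 0 <= w ->
  ((bessel p w)%:E = \int[leb]_(t in Rp) (bessel_density p w t)%:E)%E.
Proof.
move=> p01 w0; rewrite /bessel /Rintegral fineK//.
exact/integrable_fin_num/bessel_density_integrable.
Qed.

(** The inversion swaps the two terms of the exponent. It trades the order [p - 1], whose integral
    diverges at [w = 0], for [1 - p], whose integral stays bounded; the singularity is isolated in
    [w^(p-1)]. *)
Lemma bessel_inversion p w : 0 < p < 1 -> 0 < w ->
  bessel (p - 1) w = w `^ (p - 1) * bessel (1 - p) w.
Proof.
move=> /andP[p0 p1] w0.
rewrite /bessel -RintegralZl//; last first.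
  by apply: bessel_density_integrable; [rewrite subr_gt0 p1 gerBl ltW|exact: ltW].
rewrite /Rintegral; congr fine.
rewrite (ge0_integral_inversion w0); last 2 first.
- by move=> x; exact: continuous_bessel_density.
- by move=> x _; exact: bessel_density_ge0.
apply: eq_integral => x /set_mem /in_Rp x0; congr EFin.
rewrite /bessel_density /gamma_density.
have -> : w / (w / x) = x by rewrite invf_div mulrCA mulfV ?mulr1// gt_eqF.
transitivity (expR (- x) * expR (- (w / x)) * ((w / x) `^ (p - 1 - 1) * (w / x ^+ 2))).
  by ring.
rewrite powR_cdivx//.
have -> : x `^ (1 - p - 1) = (x `^ (1 + (p - 1)))^-1.
  by rewrite -powRN; congr (_ `^ _); ring.
by ring.
Qed.

Lemma poisson_kernel_laplace p c l : 0 < p <= 1 -> 0 < c -> 0 <= l ->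
  (\int[leb]_(t in Rp) (expR (- (t * l)) * (expR (- (c / t)) / t `^ (1 + p)))%:E =
   (c `^ (- p) * bessel p (c * l))%:E)%E.
Proof.
move=> p01 c0 l0; have cl0 : 0 <= c * l by rewrite mulr_ge0// ltW.
rewrite EFinM EFin_bessel//.
rewrite (ge0_integral_inversion (G := bessel_density p (c * l)) c0); last 2 first.
- by move=> x; exact: continuous_bessel_density.
- by move=> x _; exact: bessel_density_ge0.
rewrite -ge0_integralZl//; last 3 first.
- apply/measurable_EFinP; apply: continuous_measurable_Rp => x x0; apply: cvgM.
    apply: (@cvg_comp _ _ _ (fun t : R => c / t) (bessel_density p (c * l))).
      exact: continuous_cdivx.
    by apply: continuous_bessel_density; rewrite divr_gt0.
  apply: cvgMr; apply: cvgV; first by rewrite expf_neq0// gt_eqF.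
  exact: exprn_continuous.
- move=> x /in_Rp x0; rewrite lee_fin mulr_ge0 ?bessel_density_ge0//.
  by rewrite divr_ge0 ?sqr_ge0// ltW.
- by rewrite lee_fin powR_ge0.
apply: eq_integral => x /set_mem /in_Rp x0; rewrite -EFinM; congr EFin.
rewrite /bessel_density /gamma_density.
have -> : c * l / (c / x) = x * l.
  by field; rewrite !gt_eqF.
transitivity (c `^ (- p) * (expR (- (x * l)) * expR (- (c / x)) *
    ((c / x) `^ (p - 1) * (c / x ^+ 2)))); last by ring.
rewrite powR_cdivx// powRN; field.
by rewrite !gt_eqF ?powR_gt0.
Qed.

(** The absolute value gives the point [w = 0] a full neighbourhood; the limit taken there produces
    [Gamma (1 - s)]. The majorant is [gamma_density p]. *)
Lemma continuous_bessel p : 0 < p <= 1 -> continuous (fun w => bessel p `|w|).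
Proof.
move=> p01 w.
have wI : w \in `]w - 1, w + 1[%classic.
  by apply/mem_set; rewrite /= in_itv/=; apply/andP; split; lra.
have mRp : measurable (Rp : set (measurableTypeR R)) by exact: measurable_itv.
apply: (@continuity_under_integral _ _ _ leb (fun w t => bessel_density p `|w| t)
  Rp mRp (w - 1) (w + 1) _ _ (gamma_density p) (gamma_density_integrable p01) _ w wI).
- by move=> x _; apply: bessel_density_integrable.
- apply: aeW => t /in_Rp t0 x _.
  apply: cvgMl; apply: (@cvg_comp _ _ _ (fun x : R => - (`|x| / t)) expR).
    by apply: cvgN; apply: cvgMl; exact: norm_continuous.
  exact: continuous_expR.
- move=> x _; apply: aeW => t /in_Rp t0.
  by rewrite ger0_norm ?bessel_density_ge0// bessel_density_le.
Qed.

(* The functions [u_y] and [d/dy u_y] at the spectral parameter [l].  The absolute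
   value avoids [l < 0], where the integral [K_p] diverges; the spectral measures
   are carried by [l >= 0]. *)
Definition extension_symbol s y (l : R) := bessel s (y ^+ 2 / 4 * `|l|) / Gamma s.

Definition extension_symbol_deriv s y (l : R) :=
  - (2 `^ (1 - 2 * s) / Gamma s * y `^ (2 * s - 1) * `|l| `^ s *
     bessel (1 - s) (y ^+ 2 / 4 * `|l|)).

(** * Derivative and bounds of the extension symbol *)

Section extension_symbol_theory.
Variable s : R.
Hypothesis s01 : 0 < s < 1.

Let s01w : 0 < s <= 1.
Proof. by case/andP : s01 => -> /ltW ->. Qed.

Let s01c : 0 < 1 - s <= 1.
Proof. by case/andP : s01 => /ltW s0 s1; rewrite subr_gt0 s1 gerBl. Qed.

Lemma is_derive_extension_symbol y l : 0 < y ->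
  is_derive y 1 (extension_symbol s ^~ l) (extension_symbol_deriv s y l).
Proof.
move=> y0; have [s0 s1] := andP s01.
have [->|l0] := eqVneq l 0.
  rewrite /extension_symbol_deriv normr0 powR0 ?gt_eqF// mulr0 mul0r oppr0.
  have -> : extension_symbol s ^~ 0 = cst (bessel s 0 / Gamma s).
    by apply/funext => z; rewrite /extension_symbol normr0 mulr0.
  exact: is_derive_cst.
pose m : R := `|l|; have m0 : 0 < m by rewrite normr_gt0.
pose W (z : R) := z ^+ 2 / 4 * m.
have w0 : 0 < W y by rewrite mulr_gt0// divr_gt0// exprn_gt0.
have dw : is_derive y 1 W (y / 2 * m).
  by apply: is_derive_eq; rewrite /GRing.scale/=; field.
have dbw := is_derive1_comp (is_derive_bessel s01w w0) dw.
have -> : extension_symbol s ^~ l = (Gamma s)^-1 \*: (bessel s \o W).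
  by apply/funext => z; rewrite /extension_symbol mulrC.
apply: is_derive_eq.
rewrite /GRing.scale/= bessel_inversion// /extension_symbol_deriv -/m -/(W y).
have -> : 2 `^ (1 - 2 * s) / Gamma s * y `^ (2 * s - 1) * m `^ s =
    (Gamma s)^-1 * (W y `^ (s - 1) * (y / 2 * m)).
  have -> : y / 2 * m = expR (ln y - ln 2 + ln m).
    by rewrite !expRD expRN !lnK ?posrE.
  have lnW : ln (W y) = 2 * ln y - 2 * ln 2 + ln m.
    rewrite /W lnM ?posrE//; last by rewrite divr_gt0// exprn_gt0.
    rewrite ln_div ?posrE// ?exprn_gt0// lnXn// -[4]/((2 * 2)%:R) natrM -expr2 lnXn//.
    by rewrite !mulr_natl.
  rewrite !powR_expR// lnW.
  transitivity ((Gamma s)^-1 * (expR ((1 - 2 * s) * ln 2) *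
    expR ((2 * s - 1) * ln y) * expR (s * ln m))).
    by ring.
  by rewrite -!expRD; congr (_ * expR _); ring.
by ring.
Qed.

Lemma extension_symbol_deriv_le y l : 0 < y ->
  `|extension_symbol_deriv s y l| <=
  2 `^ (1 - 2 * s) / Gamma s * Gamma (1 - s) * y `^ (2 * s - 1) * `|l| `^ s.
Proof.
move=> y0; have Gs := Gamma_gt0 s01w.
have w0 : 0 <= y ^+ 2 / 4 * `|l| by rewrite mulr_ge0// divr_ge0// sqr_ge0.
rewrite normrN !normrM (ger0_norm (bessel_ge0 _ _)) !(ger0_norm (powR_ge0 _ _)).
rewrite normfV (gtr0_norm Gs).
rewrite [leRHS](_ : _ = 2 `^ (1 - 2 * s) / Gamma s * y `^ (2 * s - 1) *
  `|l| `^ s * Gamma (1 - s)); last by ring.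
rewrite ler_wpM2l ?bessel_le// !mulr_ge0 ?powR_ge0// invr_ge0 ltW//.
Qed.

(** The last factor bounds [z^(2s-1) = z^(2s) / z] for [y/2 <= z <= 2y]; splitting the power this
    way avoids a case distinction on the sign of [2s - 1]. *)
Definition extension_symbol_lip y :=
  2 `^ (1 - 2 * s) / Gamma s * Gamma (1 - s) * ((2 * y) `^ (2 * s) / (y / 2)).

Lemma extension_symbol_lip_ge0 y : 0 < y -> 0 <= extension_symbol_lip y.
Proof.
move=> y0; have Gs := Gamma_gt0 s01w; have Gs' := Gamma_gt0 s01c.
apply: mulr_ge0; first by apply: mulr_ge0; [apply: divr_ge0; [exact: powR_ge0|]|]; exact: ltW.
by apply: divr_ge0; [exact: powR_ge0|rewrite divr_ge0// ltW].
Qed.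

Lemma extension_symbol_deriv_le_near y z l : 0 < y -> y / 2 <= z <= 2 * y ->
  `|extension_symbol_deriv s z l| <= extension_symbol_lip y * `|l| `^ s.
Proof.
move=> y0 /andP[yz zy]; have Gs := Gamma_gt0 s01w; have Gs' := Gamma_gt0 s01c.
have [s0 s1] := andP s01.
have y20 : 0 < y / 2 by rewrite divr_gt0.
have z0 : 0 < z by exact: lt_le_trans yz.
apply: le_trans (extension_symbol_deriv_le _ z0) _.
rewrite ler_wpM2r ?powR_ge0// ler_wpM2l//.
  by apply: mulr_ge0; [apply: divr_ge0; [exact: powR_ge0|]|]; exact: ltW.
rewrite powRB ?(gt_eqF z0) ?implybT// (powRr1 (ltW z0)).
apply: ler_pM; rewrite ?powR_ge0 ?invr_ge0 ?(ltW z0) ?lef_pV2 ?posrE//.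
by apply: ge0_ler_powR => //; rewrite ?nnegrE ?mulr_ge0 ?ltW.
Qed.

(** Mean value theorem; [|h| < y/2] keeps the segment inside [[y/2, 2y]], where the derivative has a
    uniform bound. This is the domination of the difference quotients. *)
Lemma extension_symbol_lipschitz y h l : 0 < y -> `|h| < y / 2 ->
  `|extension_symbol s (y + h) l - extension_symbol s y l| <=
  extension_symbol_lip y * `|l| `^ s * `|h|.
Proof.
move=> y0 hy.
have key a b : y / 2 <= a -> b <= 2 * y -> a <= b ->
    `|extension_symbol s b l - extension_symbol s a l| <=
    extension_symbol_lip y * `|l| `^ s * (b - a).
  move=> ya yb; rewrite le_eqVlt => /predU1P[->|ab].
    by rewrite !subrr normr0 mulr0.
  have a0 : 0 < a by rewrite (lt_le_trans _ ya)// divr_gt0.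
  have gt0 x : a <= x -> 0 < x by exact: lt_le_trans.
  have der x : x \in `]a, b[ ->
      is_derive x 1 (extension_symbol s ^~ l) (extension_symbol_deriv s x l).
    rewrite in_itv/= => /andP[ax _].
    by apply: is_derive_extension_symbol; exact: gt0 (ltW ax).
  have cont : {within `[a, b], continuous (extension_symbol s ^~ l)}.
    apply: continuous_in_subspaceT => x /set_mem; rewrite /= in_itv/= => /andP[ax _].
    exact: is_derive_continuous (is_derive_extension_symbol l (gt0 x ax)).
  have [c] := MVT ab der cont.
  rewrite in_itv/= => /andP[ac cb] ->.
  rewrite normrM [X in _ * X]gtr0_norm ?subr_gt0// ler_wpM2r ?subr_ge0 ?(ltW ab)//.
  apply: extension_symbol_deriv_le_near => //.
  by rewrite (le_trans ya) ?(ltW ac)//= (le_trans (ltW cb)).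
have := hy; rewrite ltr_norml => /andP[h1 h2].
have [h0|h0] := leP 0 h.
  have := key y (y + h); rewrite addrAC subrr add0r (ger0_norm h0); apply; lra.
have := key (y + h) y; rewrite distrC (ltr0_norm h0).
have -> : y - (y + h) = - h by ring.
by apply; lra.
Qed.

End extension_symbol_theory.

End calculus_on_the_half_line.
(** * Bochner integrals and Laplace transforms *)

Section bochner_pairing.
Context d (T : measurableType d) (R : realType) (mu : {measure set T -> \bar R}).
Local Notation L2 := (L2 mu).
Local Notation leb := (@lebesgue_measure R).
Variable D : set R.
Hypothesis mD : measurable D.

Lemma L2simple_dot (s : seq (set R * L2)) (h : L2) : L2simple_on D s ->
  leb.-integrable D (EFin \o (fun t => L2dot (L2simple s t) h)) /\
  \int[leb]_(t in D) L2dot (L2simple s t) h = L2dot (L2simple_integral s) h.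
Proof.
elim: s => [|[A v] s IH] sD.
  have E0 t : L2dot (L2simple [::] t : L2) h = 0 by rewrite /L2simple big_nil L2dot0l.
  split.
    apply: (eq_integrable _ (cst 0%E)) => //; first by move=> t _ /=; rewrite E0.
    exact: integrable0.
  rewrite /L2simple_integral big_nil L2dot0l.
  by under eq_Rintegral do rewrite E0; rewrite Rintegral_cst// mul0r.
have [mA AD Afin] := sD A v (mem_head _ _).
have [iss Es] := IH (fun B v' Bv => sD B v' (mem_behead (s := (A, v) :: s) Bv)).
have E1 t : L2dot (L2simple ((A, v) :: s) t) h =
    L2dot v h * (\1_A t) + L2dot (L2simple s t) h.
  by rewrite /L2simple big_cons L2dotDl L2dotZl mulrC.
have iA : leb.-integrable D (EFin \o (\1_A : R -> R)).
  apply/integrableP; split.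
    by apply/measurable_EFinP; exact: measurable_indic.
  under eq_integral do rewrite /= ger0_norm//.
  by rewrite integral_indic// (setIidl AD).
have icA : leb.-integrable D (EFin \o (fun t => L2dot v h * \1_A t)).
  have : leb.-integrable D (fun t => (L2dot v h)%:E * (EFin \o (\1_A : R -> R)) t)%E.
    exact: integrableZl.
  exact: eq_integrable.
split.
  have : leb.-integrable D ((EFin \o (fun t => L2dot v h * \1_A t)%R) \+
      (EFin \o (fun t => L2dot (L2simple s t) h)))%E.
    exact: integrableD.
  by apply: eq_integrable => // t _; rewrite /= E1.
under eq_Rintegral do rewrite E1.
rewrite RintegralD// Es RintegralZl// /L2simple_integral big_cons L2dotDl L2dotZl/=.
by rewrite /Rintegral integral_indic// (setIidl AD) mulrC.
Qed.

(** Pairing with [h] costs at most a factor [||h||], so the scalar integrals of the simple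
    approximants converge both to the pairing of [I] and to the integral of the pairing. *)
Lemma L2integral_dot (F : R -> L2) (I h : L2) : is_L2integral D F I ->
  measurable_fun D (fun t => L2dot (F t) h) ->
  \int[leb]_(t in D) L2dot (F t) h = L2dot I h.
Proof.
move=> [s [sD ms sF sI]] mF.
pose sg k t := L2dot (L2simple (s k) t) h.
pose e k t := L2norm (F t - L2simple (s k) t).
have e0 k t : 0 <= e k t by exact: L2norm_ge0.
have ds k t : `|L2dot (F t) h - sg k t| <= L2norm h * e k t.
  by rewrite /sg -L2dotBl mulrC; exact: L2_CauchySchwarz.
have [iS ES] : (forall k, leb.-integrable D (EFin \o sg k)) /\
    (forall k, \int[leb]_(t in D) sg k t = L2dot (L2simple_integral (s k)) h).
  by split => k; have [] := L2simple_dot h (sD k).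
have fin k : (\int[leb]_(t in D) (e k t)%:E < +oo)%E -> leb.-integrable D (EFin \o e k).
  move=> ek; apply/integrableP; split; first by apply/measurable_EFinP; apply: ms.
  by under eq_integral do rewrite /= ger0_norm//.
(* Convergence to 0 in the extended reals makes the error integrals finite only from some index [N]
   on; the integrability of the pairing is read off at [N]. *)
have /fine_cvgP[[N _ NP] _] := sF.
have ie k : (N <= k)%N -> leb.-integrable D (EFin \o e k).
  move=> Nk; apply: fin; rewrite -ge0_fin_numE; first exact: NP.
  by apply: integral_ge0 => t _; rewrite lee_fin.
have id k : (N <= k)%N -> leb.-integrable D (EFin \o (fun t => L2dot (F t) h - sg k t)).
  move=> Nk; have : leb.-integrable D (fun t => (L2norm h)%:E * (EFin \o e k) t)%E.
    by apply: integrableZl => //; exact: ie.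
  apply: le_integrable => //.
    apply/measurable_EFinP/measurable_funB => //.
    by have /integrableP[/measurable_EFinP] := iS k.
  by move=> t _; rewrite lee_fin [leRHS]ger0_norm ?mulr_ge0 ?L2norm_ge0.
have iF : leb.-integrable D (EFin \o (fun t => L2dot (F t) h)).
  have : leb.-integrable D ((EFin \o (fun t => L2dot (F t) h - sg N t)%R) \+
      (EFin \o sg N))%E.
    by apply: integrableD => //; exact: id.
  by apply: eq_integrable => // t _; rewrite /= -EFinD subrK.
have cI : L2dot (L2simple_integral (s k)) h @[k --> \oo] --> L2dot I h.
  exact: L2cvg_dot.
have cF : L2dot (L2simple_integral (s k)) h @[k --> \oo] -->
    \int[leb]_(t in D) L2dot (F t) h.
  have ce : L2norm h * \int[leb]_(t in D) e k t @[k --> \oo] --> (0 : R).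
    rewrite -[X in _ --> X](mulr0 (L2norm h)); apply: cvgMr.
    exact: fine_cvg sF.
  apply/cvgrPdist_lt => eps eps0.
  have /cvgr0_norm_lt/(_ _ eps0) := ce.
  move=> [M _ MP]; exists (maxn M N) => // k /=; rewrite geq_max => /andP[Mk Nk].
  rewrite -ES -RintegralB//.
  apply: le_lt_trans (MP k Mk); rewrite [leRHS]ger0_norm; last first.
    by rewrite mulr_ge0 ?L2norm_ge0// Rintegral_ge0.
  rewrite -RintegralZl//; last exact: ie.
  apply: (@le_trans _ _ (\int[leb]_(t in D) `|L2dot (F t) h - sg k t|)).
    by apply: le_normr_Rintegral => //; exact: id.
  apply: le_Rintegral => //.
  - have := id k Nk; move/integrable_abse; exact: eq_integrable.
  - have : leb.-integrable D (fun t => (L2norm h)%:E * (EFin \o e k) t)%E.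
      by apply: integrableZl => //; exact: ie.
    exact: eq_integrable.
by rewrite -(cvg_lim _ cI)// -(cvg_lim _ cF).
Qed.

End bochner_pairing.
Lemma measurable_bessel (R : realType) (p c : R) : 0 < p <= 1 -> 0 <= c ->
  measurable_fun setT (fun l : R => bessel p (c * `|l|)).
Proof.
move=> p01 c0; apply: continuous_measurable_fun => l.
have -> : (fun l : R => bessel p (c * `|l|)) = (fun l => bessel p `|c * l|).
  by apply/funext => x; rewrite normrM (ger0_norm c0).
apply: (@cvg_comp _ _ _ (fun l : R => c * l) (fun w => bessel p `|w|)).
  by apply: cvgMr; exact: cvg_id.
exact: continuous_bessel.
Qed.

(** * Laplace transforms of finite measures and the Poisson kernel *)

Section laplace_transform.
Context (R : realType) (m : {finite_measure set R -> \bar R}).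
Local Notation leb := (@lebesgue_measure R).
Local Notation Rp := (`]0, +oo[%classic : set R).

(** With [|l|] the integrand is at most 1 for [t >= 0], hence integrable for any finite measure on
    the line; on [l >= 0] it is the symbol of the heat semigroup. *)
Definition laplace (t : R) : R := \int[m]_l expR (- (t * `|l|)).

Let integrand (v : R -> R) (z : R * R) : R :=
  (v \_ Rp) z.1 * expR (- (z.1 * `|z.2|)).

Lemma measurable_expR_laplace :
  measurable_fun setT (fun z : R * R => expR (- (z.1 * `|z.2|))).
Proof.
apply: measurableT_comp => //; apply: measurableT_comp => //.
by apply: measurable_funM => //; apply: measurableT_comp.
Qed.

Lemma measurable_expR_norm t : measurable_fun setT (fun l : R => expR (- (t * `|l|))).
Proof.
apply: measurableT_comp => //; apply: measurableT_comp => //.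
by apply: measurable_funM => //; exact: measurable_cst.
Qed.

Lemma integrable_expR_norm t : 0 <= t ->
  m.-integrable setT (EFin \o (fun l : R => expR (- (t * `|l|)))).
Proof.
move=> t0; apply: le_integrable (finite_measure_integrable_cst m 1 measurableT) => //.
  by apply/measurable_EFinP; exact: measurable_expR_norm.
move=> l _; rewrite lee_fin ger0_norm ?expR_ge0// ger0_norm//=.
by rewrite -expR0 ler_expR oppr_le0 mulr_ge0.
Qed.

Lemma measurable_laplace : measurable_fun setT laplace.
Proof.
apply: measurableT_comp => //.
have := @measurable_fun_fubini_tonelli_F _ _ R R R m
  (fun z => (expR (- (z.1 * `|z.2|)))%:E).
apply; first by apply/measurable_EFinP; exact: measurable_expR_laplace.
by move=> z; rewrite lee_fin expR_ge0.
Qed.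

Lemma laplace_fubini (v : R -> R) : measurable_fun Rp v ->
  (forall t, 0 <= v t) ->
  (\int[leb]_(t in Rp) (v t * laplace t)%:E =
   \int[m]_l \int[leb]_(t in Rp) (expR (- (t * `|l|)) * v t)%:E)%E.
Proof.
move=> mv v0.
have mvT : measurable_fun setT (v \_ Rp) by apply/(measurable_restrictT _ _).1.
have mint : measurable_fun setT (EFin \o integrand v).
  apply/measurable_EFinP; apply: measurable_funM; last exact: measurable_expR_laplace.
  by apply: measurableT_comp.
have vp0 t : 0 <= (v \_ Rp) t by rewrite patchE; case: ifP.
have int0 z : (0 <= (EFin \o integrand v) z)%E.
  by rewrite lee_fin mulr_ge0 ?expR_ge0.
transitivity (\int[leb]_t \int[m]_l (EFin \o integrand v) (t, l))%E.
  rewrite integral_mkcond; apply: eq_integral => t _.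
  rewrite patchE /integrand /=; have [tR|tR] := boolP (t \in Rp).
    have t0 := in_Rp (set_mem tR).
    rewrite /laplace EFinM EFin_Rintegral; last exact: integrable_expR_norm (ltW t0).
    rewrite -ge0_integralZl//.
    - by apply: eq_integral => l _; rewrite patchE tR -EFinM.
    - by apply/measurable_EFinP; exact: measurable_expR_norm.
    - by rewrite lee_fin.
  rewrite (eq_integral (cst 0%E)) ?integral0// => l _.
  by rewrite patchE (negbTE tR) mul0r.
rewrite fubini_tonelli//; apply: eq_integral => l _.
rewrite [RHS]integral_mkcond; apply: eq_integral => t _.
rewrite /integrand /= !patchE; case: ifP => _; first by rewrite mulrC.
by rewrite mul0r.
Qed.

(** Tonelli's theorem, then the kernel integral for each [l]. Integrability is recorded along with
    the value because the formula is subtracted for the two measures of a polarization. *)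
Lemma laplace_poisson_kernel (p c : R) : 0 < p <= 1 -> 0 < c ->
  \int[leb]_(t in Rp) (expR (- (c / t)) / t `^ (1 + p) * laplace t) =
  c `^ (- p) * \int[m]_l bessel p (c * `|l|) /\
  leb.-integrable Rp (EFin \o (fun t => expR (- (c / t)) / t `^ (1 + p) * laplace t)).
Proof.
move=> p01 c0.
set v := fun t : R => expR (- (c / t)) / t `^ (1 + p).
have v0 t : 0 <= v t by rewrite divr_ge0 ?expR_ge0 ?powR_ge0.
have mv : measurable_fun Rp v.
  apply: continuous_measurable_Rp => x x0; apply: cvgM.
    apply: (@cvg_comp _ _ _ (fun t : R => - (c / t)) expR); last exact: continuous_expR.
    by apply: cvgN; exact: continuous_cdivx.
  apply: cvgV; first by rewrite gt_eqF// powR_gt0.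
  exact: continuous_powR.
have ib : m.-integrable setT (EFin \o (fun l => bessel p (c * `|l|))).
  apply: le_integrable (finite_measure_integrable_cst m (Gamma p) measurableT) => //.
    by apply/measurable_EFinP; apply: measurable_bessel => //; exact: ltW.
  move=> l _; rewrite lee_fin ger0_norm ?bessel_ge0//.
  rewrite [leRHS]ger0_norm; last exact: ltW (Gamma_gt0 p01).
  by apply: bessel_le => //; rewrite mulr_ge0// ltW.
have E1 : (\int[leb]_(t in Rp) (v t * laplace t)%:E =
    (c `^ (- p) * \int[m]_l bessel p (c * `|l|))%:E)%E.
  rewrite laplace_fubini// EFinM EFin_Rintegral//.
  rewrite -ge0_integralZl//; last 3 first.
  - by apply/measurable_EFinP; apply: measurable_bessel => //; exact: ltW.
  - by move=> l _; rewrite lee_fin bessel_ge0.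
  - by rewrite lee_fin powR_ge0.
  apply: eq_integral => l _; rewrite -EFinM.
  by rewrite -poisson_kernel_laplace.
have l0 t : 0 <= laplace t by apply: Rintegral_ge0 => l _; exact: expR_ge0.
split; first by rewrite /Rintegral E1.
apply/integrableP; split.
  apply/measurable_EFinP; apply: measurable_funM => //.
  by apply: measurable_funTS; exact: measurable_laplace.
apply: (@le_lt_trans _ _ (\int[leb]_(t in Rp) (v t * laplace t)%:E)%E); last by rewrite E1 ltry.
rewrite le_eqVlt; apply/orP; left; apply/eqP; apply: eq_integral => t _.
by rewrite /= ger0_norm//; exact: mulr_ge0 (v0 t) (l0 t).
Qed.

End laplace_transform.

(* An alias of [pm_measure E h] that carries the structure of a finite measure,
   as required by Fubini's theorem. *)
Definition pm_measure_fun d (T : measurableType d) (R : realType)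
    (mu : {measure set T -> \bar R}) (E : projection_measure mu) (h : L2 mu) :
    set R -> \bar R := pm_measure E h.

HB.instance Definition _ d (T : measurableType d) (R : realType)
    (mu : {measure set T -> \bar R}) (E : projection_measure mu) (h : L2 mu) :=
  isMeasure.Build _ _ _ (pm_measure_fun E h) (measure0 (pm_measure E h))
    (measure_ge0 (pm_measure E h)) (@measure_semi_sigma_additive _ _ _ (pm_measure E h)).

Lemma pm_measure_fun_finite d (T : measurableType d) (R : realType)
    (mu : {measure set T -> \bar R}) (E : projection_measure mu) (h : L2 mu) :
  fin_num_fun (pm_measure_fun E h).
Proof. by move=> B mB; exact: pm_measure_fin. Qed.

HB.instance Definition _ d (T : measurableType d) (R : realType)
    (mu : {measure set T -> \bar R}) (E : projection_measure mu) (h : L2 mu) :=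
  Measure_isFinite.Build _ _ _ (pm_measure_fun E h) (@pm_measure_fun_finite _ _ _ _ E h).

Lemma measurable_expR_mul (R : realType) (t : R) :
  measurable_fun setT (fun l : R => expR (- (t * l))).
Proof.
apply: continuous_measurable_fun => l.
apply: (@cvg_comp _ _ _ (fun l : R => - (t * l)) expR); last exact: continuous_expR.
by apply: cvgN; apply: cvgMr; exact: cvg_id.
Qed.

(** * The extension and its derivative *)

Section nonnegative_spectrum.
Context d (T : measurableType d) (R : realType) (mu : {measure set T -> \bar R}).
Variables (E : projection_measure mu) (s : R).
Hypothesis E_neg : forall f, L2eq (E `]-oo, 0[%classic f) 0.
Hypothesis s01 : 0 < s < 1.
Local Notation L2 := (L2 mu).
Local Notation nu := (pm_measure E).
Local Notation leb := (@lebesgue_measure R).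
Local Notation Rp := (`]0, +oo[%classic : set R).
Implicit Types (f g h : L2).

Let w (l : R) : R := `|l| `^ s.

Let w_ge0 l : 0 <= w l.
Proof. exact: powR_ge0. Qed.

Let w_meas : measurable_fun setT w.
Proof. by apply: (measurableT_comp (measurable_powR s)); exact: normr_measurable. Qed.

Lemma pm_measure_neg h : nu h `]-oo, 0[%classic = 0%E.
Proof.
rewrite pm_measureE; last exact: measurable_itv.
by rewrite (eq_L2dotl _ (E_neg h)) L2dot0l.
Qed.

Lemma ae_pm_ge0 h (Q : R -> Prop) : (forall l, 0 <= l -> Q l) ->
  {ae nu h, forall l, Q l}.
Proof.
move=> Q0; exists `]-oo, 0[%classic; split; first exact: measurable_itv.
  exact: pm_measure_neg.
move=> l /=; rewrite in_itv/= => nQ; rewrite ltNge; apply/negP => l0.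
exact/nQ/Q0.
Qed.

(** Allows a symbol in [l] to be replaced by its version in [|l|], which has the growth bounds on
    the whole line. *)
Lemma eq_pm_integral h (u v : R -> R) : measurable_fun setT u ->
  measurable_fun setT v -> (forall l, 0 <= l -> u l = v l) ->
  (\int[nu h]_l (u l)%:E = \int[nu h]_l (v l)%:E)%E.
Proof.
move=> mu' mv uv; apply: ae_eq_integral => //; [exact/measurable_EFinP..|].
by apply: ae_pm_ge0 => l l0 _; rewrite uv.
Qed.

Lemma eq_pm_Rintegral h (u v : R -> R) : measurable_fun setT u ->
  measurable_fun setT v -> (forall l, 0 <= l -> u l = v l) ->
  \int[nu h]_l u l = \int[nu h]_l v l.
Proof. by move=> mu' mv uv; rewrite /Rintegral (eq_pm_integral h mu' mv uv). Qed.

Lemma calculus_dom_weight f : calculus_dom E (fun l => l `^ s) f <-> weight_dom E w f.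
Proof.
have -> : calculus_dom E (fun l => l `^ s) f <->
    (\int[nu f]_l (w l ^+ 2)%:E < +oo)%E.
  rewrite /calculus_dom/= (@eq_pm_integral f _ (fun l => w l ^+ 2))//.
  - by apply: measurable_funX; exact: measurable_powR.
  - exact: measurable_funX.
  - by move=> l l0; rewrite /w ger0_norm.
split=> [fin|/integrableP[_]]; last first.
  by under eq_integral do rewrite /= ger0_norm ?sqr_ge0//.
apply/integrableP; split; first exact/measurable_EFinP/measurable_funX.
by under eq_integral do rewrite /= ger0_norm ?sqr_ge0//.
Qed.

Lemma frac_power_represents f g : frac_power E s f g -> represents E w f w g.
Proof.
move=> [_ fg] h wh; rewrite fg; last exact/calculus_dom_weight.
have e k : \int[nu k]_l l `^ s = \int[nu k]_l w l.
  apply: (eq_pm_Rintegral k (measurable_powR s) w_meas).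
  by move=> l l0; rewrite /w ger0_norm.
by rewrite !e.
Qed.

(** The symbol is at most 1 on the spectrum, so the heat semigroup may be tested against every
    vector, whatever [t]. *)
Lemma heat_dom t h : 0 <= t -> calculus_dom E (fun l => expR (- (t * l))) h.
Proof.
move=> t0; rewrite /calculus_dom/=.
have mexp : measurable_fun setT (fun l : R => expR (- (t * l))).
  exact: measurable_expR_mul.
rewrite (@eq_pm_integral h _ (fun l => expR (- (t * `|l|)) ^+ 2)).
- apply: (@le_lt_trans _ _ (\int[nu h]_l 1%:E)%E).
    apply: ge0_le_integral => //.
    + by apply/measurable_EFinP/measurable_funX; exact: measurable_expR_norm.
    + move=> l _; rewrite lee_fin expr_le1 ?expR_ge0//.
      by rewrite -expR0 ler_expR oppr_le0 mulr_ge0.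
  by rewrite integral_cst// mul1e pm_measure_setT ltry.
- exact: measurable_funX.
- by apply: measurable_funX; exact: measurable_expR_norm.
- by move=> l l0; rewrite ger0_norm.
Qed.

Lemma heat_dot P t f h : heat_semigroup E P -> 0 <= t ->
  L2dot (P t f) h =
  (laplace (pm_measure_fun E (f + h)) t - laplace (pm_measure_fun E (f - h)) t) / 4.
Proof.
move=> heatP t0; have [_ ->] := heatP t f t0; last exact: heat_dom.
have e k : \int[nu k]_l expR (- (t * l)) = laplace (pm_measure_fun E k) t.
  apply: (eq_pm_Rintegral k (measurable_expR_mul t) (measurable_expR_norm t)).
  by move=> l l0; rewrite ger0_norm.
by rewrite !e.
Qed.

Let s01w : 0 < s <= 1.
Proof. by case/andP : s01 => -> /ltW ->. Qed.

(** Pairing the Bochner integral with [h] leaves a scalar integral of heat pairings; polarization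
    splits it into two Laplace transforms, each integrated against the Poisson kernel. *)
Lemma harmonic_extension_represents P f U (y : R) : heat_semigroup E P ->
  harmonic_extension P s f U -> 0 < y ->
  represents E w f (extension_symbol s y) (U y).
Proof.
move=> heatP ext y0 h _; have [I intI UI] := ext y y0.
pose c := y ^+ 2 / 4.
have c0 : 0 < c by rewrite divr_gt0// exprn_gt0.
pose v t := expR (- (c / t)) / t `^ (1 + s).
pose A t := laplace (pm_measure_fun E (f + h)) t.
pose B t := laplace (pm_measure_fun E (f - h)) t.
have dotE t : Rp t -> L2dot ((expR (- (y ^+ 2 / (4 * t))) / t `^ (1 + s)) *: P t f) h =
    4^-1 * (v t * A t - v t * B t).
  move=> /in_Rp t0; rewrite L2dotZl (heat_dot _ _ heatP (ltW t0)).
  have -> : y ^+ 2 / (4 * t) = c / t by rewrite /c invfM mulrA.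
  by rewrite -/(A t) -/(B t) -/(v t); field.
have [EA iA] := laplace_poisson_kernel (pm_measure_fun E (f + h)) s01w c0.
have [EB iB] := laplace_poisson_kernel (pm_measure_fun E (f - h)) s01w c0.
have iAB : leb.-integrable Rp (EFin \o (fun t => v t * A t - v t * B t)).
  have : leb.-integrable Rp ((EFin \o (fun t => v t * A t)%R) \-
      (EFin \o (fun t => v t * B t)%R))%E.
    exact: integrableB.
  exact: eq_integrable.
have dotI : L2dot I h = 4^-1 * (c `^ (- s) * \int[nu (f + h)]_l bessel s (c * `|l|) -
    c `^ (- s) * \int[nu (f - h)]_l bessel s (c * `|l|)).
  rewrite -EA -EB -RintegralB// -RintegralZl//.
  rewrite -(L2integral_dot _ intI)//.
  - by apply: eq_Rintegral => t /set_mem /dotE.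
  - apply: (eq_measurable_fun (fun t => 4^-1 * (v t * A t - v t * B t))).
      by move=> t /set_mem /dotE.
    apply: measurable_funM => //; apply: measurable_funB.
    + by have /integrableP[/measurable_EFinP] := iA.
    + by have /integrableP[/measurable_EFinP] := iB.
have mb h' : \int[nu h']_l extension_symbol s y l =
    (Gamma s)^-1 * \int[nu h']_l bessel s (c * `|l|).
  rewrite -RintegralZl//; first by apply: eq_Rintegral => l _; rewrite mulrC.
  have mbes : measurable_fun setT (fun l : R => bessel s (c * `|l|)).
    by apply: measurable_bessel => //; exact: ltW.
  apply: le_integrable (pm_integrable_cst E h' (Gamma s)) => //.
    exact/measurable_EFinP.
  move=> l _; rewrite lee_fin ger0_norm ?bessel_ge0//.
  rewrite [leRHS]ger0_norm; last exact: ltW (Gamma_gt0 s01w).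
  by apply: bessel_le => //; rewrite mulr_ge0// ltW.
(* The prefactor of the Poisson formula exactly cancels the power of [c = y^2 / 4] left by the
   inversion. *)
have yc : y `^ (2 * s) / 2 `^ (2 * s) * c `^ (- s) = 1.
  have lnc : ln c = 2 * ln y - 2 * ln 2.
    rewrite /c ln_div ?posrE// ?exprn_gt0// lnXn// -[4]/((2 * 2)%:R) natrM -expr2 lnXn//.
    by rewrite !mulr_natl.
  rewrite !powR_expR// lnc -expRN -!expRD -[RHS]expR0; congr expR; ring.
rewrite (eq_L2dotl _ UI) L2dotZl dotI !mb -mulrBr.
set X := _ - _; set X' := (Gamma s)^-1 * _ - _.
have -> : X' = (Gamma s)^-1 * X by rewrite /X' /X; ring.
transitivity (y `^ (2 * s) / 2 `^ (2 * s) * c `^ (- s) * ((Gamma s)^-1 * X / 4)).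
  by rewrite invfM; ring.
by rewrite yc mul1r.
Qed.

Lemma measurable_extension_symbol (y : R) : measurable_fun setT (extension_symbol s y).
Proof.
apply: measurable_funM; last exact: measurable_cst.
by apply: measurable_bessel => //; rewrite divr_ge0 ?sqr_ge0.
Qed.

Let s01c : 0 < 1 - s <= 1.
Proof. by case/andP : s01 => /ltW s0 s1; rewrite subr_gt0 s1 gerBl. Qed.

Lemma measurable_extension_symbol_deriv (y : R) :
  measurable_fun setT (extension_symbol_deriv s y).
Proof.
rewrite /extension_symbol_deriv; apply: measurableT_comp => //.
apply: measurable_funM; last first.
  by apply: measurable_bessel => //; rewrite divr_ge0 ?sqr_ge0.
by apply: measurable_funM => //; exact: measurable_cst.
Qed.

Lemma dominated_extension_symbol (y : R) : dominated w (extension_symbol s y).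
Proof.
split; first exact: measurable_extension_symbol.
exists 1 => l; rewrite mul1r.
have Gs := Gamma_gt0 s01w.
apply: (@le_trans _ _ 1); last by rewrite lerDl.
rewrite ger0_norm ?divr_ge0 ?bessel_ge0 ?(ltW Gs)// ler_pdivrMr// mul1r.
by apply: bessel_le => //; rewrite mulr_ge0// divr_ge0// sqr_ge0.
Qed.

Lemma extension_symbol_quotient_cvg (y l : R) (t_ : nat -> R) : 0 < y ->
  (forall n, t_ n != 0) -> t_ n @[n --> \oo] --> 0 ->
  (t_ n)^-1 * (extension_symbol s (y + t_ n) l - extension_symbol s y l)
    @[n --> \oo] --> extension_symbol_deriv s y l.
Proof.
move=> y0 t0 tcvg.
have [df dE] := is_derive_extension_symbol s01 l y0.
have : (fun h : R => h^-1 *: (extension_symbol s (h *: 1 + y) l - extension_symbol s y l))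
    @ 0^' --> 'D_1 (extension_symbol s ^~ l) y by exact: df.
rewrite dE => /cvgr_dnbhsP/(_ t_ (conj t0 tcvg)) cv.
apply: cvg_trans cv; apply: near_eq_cvg; apply: nearW => n.
by rewrite /GRing.scale/= mulr1 (addrC y).
Qed.

(** * Difference quotients in [y] and the weighted limit at 0 *)

Section extension_derivative.
Variables (P : R -> L2 -> L2) (f g0 : L2) (U : R -> L2).
Hypothesis heatP : heat_semigroup E P.
Hypothesis extU : harmonic_extension P s f U.
Hypothesis frac_f : frac_power E s f g0.

Let wf : weight_dom E w f.
Proof. by apply/calculus_dom_weight; case: frac_f. Qed.

Let lip_dom (y l : R) : 0 < y ->
  extension_symbol_lip s y * `|l| `^ s <= extension_symbol_lip s y * (1 + w l).
Proof. by move=> y0; rewrite ler_wpM2l ?extension_symbol_lip_ge0// lerDr. Qed.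

Lemma quotient_represents (y t : R) : 0 < y -> `|t| < y / 2 ->
  represents E w f
    (fun l => t^-1 * (extension_symbol s (y + t) l - extension_symbol s y l))
    (t^-1 *: (U (y + t) - U y)).
Proof.
move=> y0; rewrite ltr_norml => /andP[t1 t2].
have yt0 : 0 < y + t by lra.
have dy := dominated_extension_symbol y.
have dyt := dominated_extension_symbol (y + t).
have rB : represents E w f
    (fun l => extension_symbol s (y + t) l - extension_symbol s y l) (U (y + t) - U y).
  apply: representsB => //; exact: harmonic_extension_represents heatP extU _.
apply: representsZ => //; exact: dominatedB.
Qed.

Lemma quotient_le (y t l : R) : 0 < y -> t != 0 -> `|t| < y / 2 ->
  `|t^-1 * (extension_symbol s (y + t) l - extension_symbol s y l)| <=
  extension_symbol_lip s y * (1 + w l).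
Proof.
move=> y0 t0 ty; apply: le_trans (lip_dom l y0).
rewrite normrM normfV mulrC ler_pdivrMr ?normr_gt0//.
exact: extension_symbol_lipschitz.
Qed.

Lemma measurable_quotient (y t : R) : measurable_fun setT
  (fun l => t^-1 * (extension_symbol s (y + t) l - extension_symbol s y l)).
Proof.
apply: measurable_funM; first exact: measurable_cst.
by apply: measurable_funB; exact: measurable_extension_symbol.
Qed.

Lemma extension_symbol_deriv_le_weight (y l : R) : 0 < y ->
  `|extension_symbol_deriv s y l| <= extension_symbol_lip s y * (1 + w l).
Proof.
move=> y0; apply: le_trans (lip_dom l y0).
by apply: extension_symbol_deriv_le_near => //; apply/andP; split; lra.
Qed.

Lemma extension_symbol_deriv_representative (y : R) : 0 < y ->
  exists v, represents E w f (extension_symbol_deriv s y) v.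
Proof.
(* Any null sequence of nonzero steps below [y/2] would do; [n.+2] keeps the inequality strict at
   [n = 0]. *)
move=> y0; pose t n : R := y / 2 / n.+2%:R.
have tgt0 n : 0 < t n by rewrite !divr_gt0.
have ty n : `|t n| < y / 2.
  by rewrite gtr0_norm// ltr_pdivrMr// ltr_pMr ?divr_gt0// ltr1n.
have tcvg : t n @[n --> \oo] --> 0.
  rewrite -(mulr0 (y / 2)); apply: cvgMr.
  have := @cvg_harmonic R; rewrite -(cvg_shiftn 1).
  by under eq_fun do rewrite addn1.
apply: (represents_lim w_ge0 w_meas wf (fun n => measurable_quotient y (t n))
   (measurable_extension_symbol_deriv y) (fun n l => quotient_le l y0 (lt0r_neq0 (tgt0 n)) (ty n))
   (fun l => extension_symbol_deriv_le_weight l y0)).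
  by move=> l; apply: extension_symbol_quotient_cvg => // n; exact: lt0r_neq0.
by move=> n; exact: quotient_represents (ty n).
Qed.

(** Dominated convergence is sequential, so the limit is tested along arbitrary null sequences,
    shifted until their terms are below [y/2]. *)
Lemma represents_is_L2derive (y : R) (v : L2) : 0 < y ->
  represents E w f (extension_symbol_deriv s y) v -> is_L2derive U y v.
Proof.
move=> y0 rv; apply/cvgr_dnbhsP => t [t0 tcvg].
have y20 : 0 < y / 2 by rewrite divr_gt0.
have /cvgr0_norm_lt/(_ _ y20)[N _ NP] := tcvg.
rewrite -(cvg_shiftn N).
have ty n : `|t (n + N)%N| < y / 2 by apply: NP; rewrite /= leq_addl.
apply: (represents_cvg w_ge0 w_meas wf
   (fun n => measurable_quotient y (t (n + N)%N))
   (measurable_extension_symbol_deriv y)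
   (fun n l => quotient_le l y0 (t0 (n + N)%N) (ty n))
   (fun l => extension_symbol_deriv_le_weight l y0) _ (fun n => quotient_represents y0 (ty n)) rv).
move=> l; apply: extension_symbol_quotient_cvg => //.
by rewrite cvg_shiftn.
Qed.

(** The reciprocal of the constant [2^(2s-1) Gamma s / Gamma (1 - s)] of the theorem. *)
Let kappa : R := 2 `^ (1 - 2 * s) / Gamma s * Gamma (1 - s).

Let kappa_ge0 : 0 <= kappa.
Proof.
have Gs := Gamma_gt0 s01w; have Gs' := Gamma_gt0 s01c.
by apply: mulr_ge0; [apply: divr_ge0; [exact: powR_ge0|]|]; exact: ltW.
Qed.

(** The powers of [y] cancel, leaving [y] only inside [bessel]; the outer absolute value matches
    [continuous_bessel]. *)
Lemma weighted_derivE (y l : R) : 0 < y ->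
  y `^ (1 - 2 * s) * extension_symbol_deriv s y l =
  - (2 `^ (1 - 2 * s) / Gamma s * w l * bessel (1 - s) `|y ^+ 2 / 4 * `|l| |).
Proof.
move=> y0; rewrite ger0_norm; last by rewrite mulr_ge0// divr_ge0// sqr_ge0.
have yy : y `^ (1 - 2 * s) * y `^ (2 * s - 1) = 1.
  by rewrite !powR_expR// -expRD -[RHS]expR0; congr expR; ring.
rewrite /extension_symbol_deriv -/(w l).
transitivity (y `^ (1 - 2 * s) * y `^ (2 * s - 1) *
  - (2 `^ (1 - 2 * s) / Gamma s * w l * bessel (1 - s) (y ^+ 2 / 4 * `|l|))).
  by ring.
by rewrite yy mul1r.
Qed.

Lemma weighted_deriv_le (y l : R) : 0 < y ->
  `|y `^ (1 - 2 * s) * extension_symbol_deriv s y l| <= kappa * (1 + w l).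
Proof.
move=> y0; have Gs := Gamma_gt0 s01w.
have c0 : 0 <= 2 `^ (1 - 2 * s) / Gamma s * w l.
  by rewrite mulr_ge0// divr_ge0 ?powR_ge0// ltW.
rewrite weighted_derivE// normrN ger0_norm; last by rewrite mulr_ge0// bessel_ge0.
apply: (@le_trans _ _ (kappa * w l)); last by rewrite ler_wpM2l// lerDr.
rewrite /kappa [leRHS]mulrAC; apply: (ler_wpM2l c0); exact: bessel_le.
Qed.

Lemma weighted_deriv_cvg (l : R) (t : nat -> R) : (forall n, 0 < t n) ->
  t n @[n --> \oo] --> 0 ->
  t n `^ (1 - 2 * s) * extension_symbol_deriv s (t n) l @[n --> \oo] -->
  - kappa * w l.
Proof.
move=> t0 tcvg; under eq_fun do rewrite weighted_derivE//.
have -> : - kappa * w l = - (2 `^ (1 - 2 * s) / Gamma s * w l * bessel (1 - s) `|(0 : R)|).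
  by rewrite normr0 bessel0 /kappa; ring.
apply: cvgN; apply: cvgMr.
apply: (@cvg_comp _ _ _ (fun n => t n ^+ 2 / 4 * `|l|) (fun z => bessel (1 - s) `|z|));
  last exact: continuous_bessel.
have -> : (0 : R) = 0 ^+ 2 / 4 * `|l| by rewrite expr0n !mul0r.
apply: cvgMl; apply: cvgMl.
apply: (@cvg_comp _ _ _ t (fun z : R => z ^+ 2) _ _ _ tcvg).
exact: exprn_continuous.
Qed.

(** The domination [kappa * (1 + w l)] is uniform in [y], whereas [extension_symbol_lip s y] is of
    order [y^(2s-1)] and blows up at 0 when [s < 1/2]. *)
Lemma weighted_derivative_cvg (dU : R -> L2) :
  (forall y, 0 < y -> represents E w f (extension_symbol_deriv s y) (dU y)) ->
  L2cvg (0 : R)^'+ (fun y => y `^ (1 - 2 * s) *: dU y) (- kappa *: g0).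
Proof.
move=> rdU; apply/cvg_at_rightP => t [t0 tcvg].
have mw : dominated w w by split => //; exists 1 => l; rewrite mul1r ger0_norm// lerDr.
have md y : 0 < y -> dominated w (extension_symbol_deriv s y).
  by move=> y0; split; [exact: measurable_extension_symbol_deriv|
    exists (extension_symbol_lip s y) => l; exact: extension_symbol_deriv_le_weight].
apply: (@represents_cvg _ _ _ _ E w w_ge0 w_meas f kappa
  (fun n l => t n `^ (1 - 2 * s) * extension_symbol_deriv s (t n) l)
  (fun l => - kappa * w l)) => //.
- by move=> n; apply: measurable_funM => //; exact: measurable_extension_symbol_deriv.
- exact: measurable_funM.
- by move=> n l; exact: weighted_deriv_le.
- move=> l; rewrite normrM normrN (ger0_norm kappa_ge0) (ger0_norm (w_ge0 l)).
  by rewrite ler_wpM2l// lerDr.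
- by move=> l; exact: weighted_deriv_cvg.
- by move=> n; apply: representsZ => //; [exact: md|exact: rdU].
- by apply: representsZ => //; exact: frac_power_represents.
Qed.

Lemma frac_power_weighted_derivative : exists (dU : R -> L2) (l : L2),
  [/\ forall y, 0 < y -> is_L2derive U y (dU y),
      L2cvg (0 : R)^'+ (fun y => y `^ (1 - 2 * s) *: dU y) l
    & frac_power E s f (- (2 `^ (2 * s - 1) * Gamma s / Gamma (1 - s)) *: l)].
Proof.
have /choice[dU dUP] : forall y : R, exists v : L2,
    0 < y -> represents E w f (extension_symbol_deriv s y) v.
  move=> y; have [y0|_] := ltP 0 y; last by exists 0.
  by have [v rv] := extension_symbol_deriv_representative y0; exists v.
exists dU, (- kappa *: g0); split.
- by move=> y y0; apply: represents_is_L2derive => //; exact: dUP.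
- exact: weighted_derivative_cvg.
(* With the limit taken to be [- kappa *: g0], the scalars multiply to 1 and the vector is literally
   [g0]. *)
- rewrite scalerA mulrNN.
  have -> : 2 `^ (2 * s - 1) * Gamma s / Gamma (1 - s) * kappa = 1.
    have Gs := lt0r_neq0 (Gamma_gt0 s01w); have Gs' := lt0r_neq0 (Gamma_gt0 s01c).
    have pw : (2 : R) `^ (2 * s - 1) * 2 `^ (1 - 2 * s) = 1.
      by rewrite !powR_expR// -expRD -[RHS]expR0; congr expR; ring.
    set A := 2 `^ (2 * s - 1); set B := 2 `^ (1 - 2 * s).
    transitivity (A * B); last exact: pw.
    rewrite /kappa -/B; set G := Gamma s in Gs *; set G' := Gamma (1 - s) in Gs' *.
    by field; rewrite Gs Gs'.
  by rewrite scale1r.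
Qed.

End extension_derivative.

End nonnegative_spectrum.

Theorem lemma3p2 (R : realType) (X : pmetricType R)
    (mu : {measure set (borel X) -> \bar R})
    (Dom : set (L2 mu)) (En : L2 mu -> L2 mu -> R)
    (L : operator mu) (E : projection_measure mu) (P : R -> L2 mu -> L2 mu)
    (s a : R) (f : L2 mu) (U : R -> L2 mu)
    (X_lc : locally_compact [set: X])
    (mu_radon : radon mu) (mu_supp : full_support mu)
    (En_dirichlet : dirichlet_form Dom En)
    (L_generator : generator Dom En L E)
    (L_gap : no_spectral_gap L)
    (P_heat : heat_semigroup E P)
    (s_gt0 : 0 < s) (s_lt1 : s < 1) (a_def : a = 1 - 2 * s)
    (f_dom : op_dom (frac_power E s) f)
    (U_ext : harmonic_extension P s f U) :
  exists (dU : R -> L2 mu) (l : L2 mu),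
    [/\ forall y, 0 < y -> is_L2derive U y (dU y),
        L2cvg (0 : R)^'+ (fun y => y `^ a *: dU y) l
      & frac_power E s f (- (2 `^ (2 * s - 1) * Gamma s / Gamma (1 - s)) *: l)].
Proof.
have [_ _ [E_neg _] _ _] := L_generator; have [g fg] := f_dom.
have s01 : 0 < s < 1 by rewrite s_gt0.
by rewrite a_def; exact: (frac_power_weighted_derivative E_neg s01 P_heat U_ext fg).
Qed.
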